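(* Assume $h<H$. The joint probability vectors of queue content and server content at service completion epochs satisfy, for all $n\ge0$, $$\xi^{+}(n,h)=\Big((1-\epsilon)\sum_{j=0}^{h-1}\gamma^{+}(j)\tilde D^{\,h-j}+\gamma^{+}(h)+\xi^{+}(h)\Big)A^{(h)}_n,$$ $$\xi^{+}(n,r)=\big(\gamma^{+}(r)+\xi^{+}(r)\big)A^{(r)}_n,\qquad h+1\le r\le H-1 .$$
   Context: Model. Single-server queue with infinite buffer. Customers arrive according to a Markovian arrival process (MAP) with $m$ phases and $m\times m$ matrices $C=(c_{i,j})$ (transition rates without arrival; negative diagonal, non-negative off-diagonal, $C$ invertible) and $D=(d_{i,j})\ge 0$ (transition rates with one arrival); $C+D$ is the infinitesimal generator of the underlying phase chain, with stationary probability vector $\bar\xi$ ($\bar\xi(C+D)=\mathbf 0$, $\bar\xi\mathbf e=1$), and $\lambda=\bar\xi D\mathbf e$. Here $\mathbf e$ is the $m\times1$ column of ones and $I$ the identity. Put $\tilde D=(-C)^{-1}D$. Integers $1\le h\le H$ are service thresholds. When a service ends and the queue length is $l\ge h$, the server immediately serves a batch of size $\min(l,H)$. A batch of size $r$ ($h\le r\le H$) has service time with density $s_r(t)$ and finite mean $s_r=1/\mu_r$. If at the end of a service the queue length is $k<h$, the server starts a vacation of type $k$, with density $v_k(t)$ and finite mean $x_k=1/\nu_k$ ($0\le k\le h-1$). If at the end of a vacation the queue length is $l\ge h$, a batch of size $\min(l,H)$ is served. If it is $l<h$: under single vacation (SV, $\epsilon=0$) the server stays dormant until the queue length reaches $h$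 and then serves these $h$ customers; under multiple vacation (MV, $\epsilon=1$) it starts a new vacation of type $l$. Arrivals, service times and vacation times are independent. Stability $\lambda s_H/H<1$ holds and the system is in steady state. Steady-state quantities (row vectors over phases $i=1,\dots,m$). $R(n,0)$, $0\le n\le h-1$ (SV only): probability that the queue length is $n$, the server is dormant and the phase is $i$. $\xi(n,r,u)$, $n\ge0$, $h\le r\le H$: density in $u$ of queue length $n$, a batch of size $r$ in service, phase $i$, remaining service time $u$. $\gamma(n,k,u)$, $0\le k\le h-1$, $n\ge k$: density in $u$ of queue length $n$, vacation of type $k$ in progress, phase $i$, remaining vacation time $u$. Set $\gamma(n,k,0)=0$ for $n<k$. They satisfy $0=(1-\epsilon)(R(0,0)C+\gamma(0,0,0))$; $0=(1-\epsilon)(R(n,0)C+R(n-1,0)D+\sum_{k=0}^{n}\gamma(n,k,0))$, $1\le n\le h-1$; $-\frac{d}{du}\xi(0,h,u)=\xi(0,h,u)C+(1-\epsilon)R(h-1,0)D\,s_h(u)+(\sum_{k=0}^{h-1}\gamma(h,k,0)+\sum_{j=h}^{H}\xi(h,j,0))s_h(u)$; $-\frac{d}{du}\xi(0,r,u)=\xi(0,r,u)C+(\sum_{k=0}^{h-1}\gamma(r,k,0)+\sum_{j=h}^{H}\xi(r,j,0))s_r(u)$, $h+1\le r\le H$; $-\frac{d}{du}\xi(n,r,u)=\xi(n,r,u)C+\xi(n-1,r,u)D$, $h\le r\le H-1$, $n\ge1$; $-\frac{d}{du}\xi(n,H,u)=\xi(n,H,u)C+\xi(n-1,H,u)D+(\sum_{k=0}^{h-1}\gamma(n+H,k,0)+\sum_{j=h}^{H}\xi(n+H,j,0))s_H(u)$,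 $n\ge1$; $-\frac{d}{du}\gamma(k,k,u)=\gamma(k,k,u)C+(\sum_{r=h}^{H}\xi(k,r,0)+\epsilon\sum_{j=0}^{k}\gamma(k,j,0))v_k(u)$, $0\le k\le h-1$; $-\frac{d}{du}\gamma(n,k,u)=\gamma(n,k,u)C+\gamma(n-1,k,u)D$, $n\ge k+1$, $0\le k\le h-1$. Completion-epoch probabilities. Consider all epochs at which a service ends or a vacation ends, pooled together. In steady state at such epochs, $\xi_i^{+}(n,r)$ is the probability that the epoch is the end of service of a batch of size $r$ with $n$ customers in the queue (before the next service or vacation starts) and phase $i$, and $\gamma_i^{+}(n,k)$ is the probability that it is the end of a vacation of type $k$ with $n$ customers in the queue and phase $i$. Thus $\sum_{n\ge0}\sum_{r=h}^{H}\xi^{+}(n,r)\mathbf e+\sum_{n\ge0}\sum_{k=0}^{\min(n,h-1)}\gamma^{+}(n,k)\mathbf e=1$, with row vectors $\xi^{+}(n,r)=(\xi_i^{+}(n,r))_{i}$, $\gamma^{+}(n,k)=(\gamma_i^{+}(n,k))_{i}$. Put $\xi^{+}(n)=\sum_{r=h}^{H}\xi^{+}(n,r)$ and $\gamma^{+}(n)=\sum_{k=0}^{\min(n,h-1)}\gamma^{+}(n,k)$, $n\ge0$. Arrivals during a service. For $h\le r\le H$, $A^{(r)}_l$ ($l\ge0$) is the $m\times m$ matrix whose $(i,j)$ entry is the probability that, given a service of a batch of size $r$ starts with the arrival process in phase $i$, exactly $l$ customers arrive during the service and the phase at its end is $j$; equivalently $\sum_{l\ge0}A^{(r)}_l z^l=A^{(r)}(z)=\int_0^\infty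 e^{(C+Dz)t}s_r(t)\,dt$ for $|z|\le1$. *)

(* Defs.v *)
From HB Require Import structures.
From mathcomp Require Import all_boot all_order all_algebra.
From mathcomp Require Import all_classical all_reals all_analysis.

Set Implicit Arguments.
Unset Strict Implicit.
Unset Printing Implicit Defensive.

Import Order.TTheory GRing.Theory Num.Theory.
Import numFieldNormedType.Exports.

Local Open Scope classical_set_scope.
Local Open Scope ring_scope.

Section Queue.
Variables (R : realType) (m : nat).

Local Notation mu := (@lebesgue_measure R).
Local Notation e := (const_mx 1 : 'cV[R]_m).
Local Notation Rp := (`[0, +oo[%classic : set R).

Implicit Types (C D : 'M[R]_m) (f : R -> R).

(** ** Arrivals *)

Record is_map C D : Prop := IsMap {
  map_diag : forall i, C i i < 0 ;
  map_offdiag : forall i j, i != j -> 0 <= C i j ;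
  map_inv : C \in unitmx ;
  map_arr : forall i j, 0 <= D i j ;
  map_gen : (C + D) *m e = 0 }.

Record is_stationary (Q : 'M[R]_m) (p : 'rV[R]_m) : Prop := IsStationary {
  stat_ge0 : forall i, 0 <= p 0 i ;
  stat_balance : p *m Q = 0 ;
  stat_sum1 : (p *m e) 0 0 = 1 }.

Definition arrival_rate D (p : 'rV[R]_m) : R := (p *m D *m e) 0 0.

Definition Dtilde C D : 'M[R]_m := invmx (- C) *m D.

(** [jump_mx C D k l] is the coefficient of z^l in (C + D z)^k; it is the
    ((0, i), (l, j)) entry of the k-th power of the (bounded) generator of the
    Markov chain (number of arrivals, phase). *)
Definition jump_mx C D (k l : nat) : 'M[R]_m :=
  \matrix_(i, j)
    (((map_mx polyC C + 'X *: map_mx polyC D : 'M[{poly R}]_m) ^+ k) i j)`_l.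

(** Transition probabilities of that chain, i.e. the coefficient of z^l in
    exp((C + D z) t): probability, starting in phase i, of having l arrivals
    during a time t and of being in phase j at its end. *)
Definition count_mx C D (l : nat) (t : R) : 'M[R]_m :=
  \matrix_(i, j)
    limn (series (fun k => t ^+ k / k`!%:R * jump_mx C D k l i j)).

(** Same quantity over an independent random time with density [f]; for
    [f = s r] this is the matrix A^(r)_l. *)
Definition arrivals_mx C D f (l : nat) : 'M[R]_m :=
  \matrix_(i, j) \int[mu]_(t in Rp) (count_mx C D l t i j * f t).

(** ** Service and vacation times *)

Definition mean_time f : \bar R := (\int[mu]_(t in Rp) (t * f t)%:E)%E.

Record is_time_density f : Prop := IsTimeDensity {
  dens_meas : measurable_fun Rp f ;
  dens_ge0 : forall t, 0 <= t -> 0 <= f t ;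
  dens_sum1 : (\int[mu]_(t in Rp) (f t)%:E = 1)%E ;
  dens_mean : (mean_time f < +oo)%E }.

(** ** Steady state at an arbitrary time *)

(** - d/du f = g on [0, +oo[.  Service and vacation densities are merely
    measurable, so the equation is understood in the sense of Caratheodory:
    f is an indefinite integral of - g.  A classical solution with continuous
    [g] is a particular case. *)
Definition solves_neg_deriv (f g : R -> 'rV[R]_m) : Prop :=
  forall (i : 'I_m) (u w : R), 0 <= u -> u <= w ->
    f u 0 i - f w 0 i = \int[mu]_(t in `[u, w]) (g t 0 i).

Record is_partial_density (f : R -> 'rV[R]_m) : Prop := IsPartialDensity {
  pdens_meas : forall i, measurable_fun Rp (fun u => f u 0 i) ;
  pdens_ge0 : forall i u, 0 <= u -> 0 <= f u 0 i }.

Section SteadyState.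
Variables (h H : nat).
(* false : single vacation (epsilon = 0); true : multiple (epsilon = 1) *)
Variable (eps : bool).
Variables (C D : 'M[R]_m) (s v : nat -> R -> R).
Variables (idle : nat -> 'rV[R]_m) (xi gam : nat -> nat -> R -> 'rV[R]_m).

(** Probability that a service or a vacation is in progress and that its
    remaining time belongs to [S]. *)
Definition active_mass (S : set R) : \bar R :=
  (\sum_(0 <= n <oo)
     (\sum_(h <= r < H.+1) \int[mu]_(u in S) ((xi n r u *m e) 0 0)%:E
      + \sum_(0 <= k < (minn n h.-1).+1)
          \int[mu]_(u in S) ((gam n k u *m e) 0 0)%:E))%E.

(** Flow into the services started with a queue length [l >= h]. *)
Definition start_flow (l : nat) : 'rV[R]_m :=
  \sum_(0 <= k < h) gam l k 0 + \sum_(h <= j < H.+1) xi l j 0.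

Record is_steady_state : Prop := IsSteadyState {
  ss_idle_ge0 : forall n i, (n < h)%N -> 0 <= idle n 0 i ;
  ss_xi_dens : forall n r, (h <= r <= H)%N -> is_partial_density (xi n r) ;
  ss_gam_dens : forall n k, (k < h)%N -> (k <= n)%N ->
    is_partial_density (gam n k) ;
  ss_total :
    (((1 - eps%:R) * \sum_(0 <= n < h) (idle n *m e) 0 0)%:E
      + active_mass Rp = 1)%E ;
  ss_gam_conv : forall n k, (k < h)%N -> (n < k)%N -> gam n k 0 = 0 ;
  ss_idle0 : 0 = (1 - eps%:R) *: (idle 0%N *m C + gam 0%N 0%N 0) ;
  ss_idle : forall n, (1 <= n < h)%N ->
    0 = (1 - eps%:R) *:
        (idle n *m C + idle n.-1 *m D + \sum_(0 <= k < n.+1) gam n k 0) ;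
  ss_xi0h : solves_neg_deriv (xi 0%N h) (fun u =>
    xi 0%N h u *m C + ((1 - eps%:R) * s h u) *: (idle h.-1 *m D)
    + s h u *: start_flow h) ;
  ss_xi0 : forall r, (h.+1 <= r <= H)%N ->
    solves_neg_deriv (xi 0%N r) (fun u =>
      xi 0%N r u *m C + s r u *: start_flow r) ;
  ss_xi : forall n r, (1 <= n)%N -> (h <= r <= H.-1)%N ->
    solves_neg_deriv (xi n r) (fun u =>
      xi n r u *m C + xi n.-1 r u *m D) ;
  ss_xiH : forall n, (1 <= n)%N ->
    solves_neg_deriv (xi n H) (fun u =>
      xi n H u *m C + xi n.-1 H u *m D + s H u *: start_flow (n + H)) ;
  ss_gam0 : forall k, (k < h)%N ->
    solves_neg_deriv (gam k k) (fun u =>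
      gam k k u *m C
      + v k u *: (\sum_(h <= r < H.+1) xi k r 0
                  + eps%:R *: \sum_(0 <= j < k.+1) gam k j 0)) ;
  ss_gam : forall n k, (k < h)%N -> (k.+1 <= n)%N ->
    solves_neg_deriv (gam n k) (fun u =>
      gam n k u *m C + gam n.-1 k u *m D) }.

(** ** Steady state at completion epochs *)

Variables (xip gamp : nat -> nat -> 'rV[R]_m).

Definition xip_tot (n : nat) : 'rV[R]_m := \sum_(h <= r < H.+1) xip n r.

Definition gamp_tot (n : nat) : 'rV[R]_m :=
  \sum_(0 <= k < (minn n h.-1).+1) gamp n k.

(** Conditional probability that the activity in progress, the queue length and
    the phase are those described by the density [f], given that the remaining
    time of the activity in progress is at most [d]. *)
Definition completion_cond (f : R -> 'rV[R]_m) (i : 'I_m) (d : R) : R :=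
  (\int[mu]_(u in `[0, d]) (f u 0 i)) / fine (active_mass `[0, d]).

(** The distribution at the (pooled) completion epochs is the law of the
    stationary system given a completion within the next [d] units of time,
    as [d] tends to 0. *)
Record is_completion_law : Prop := IsCompletionLaw {
  cl_xi : forall n r i, (h <= r <= H)%N ->
    completion_cond (xi n r) i d @[d --> 0^'+] --> xip n r 0 i ;
  cl_gam : forall n k i, (k < h)%N -> (k <= n)%N ->
    completion_cond (gam n k) i d @[d --> 0^'+] --> gamp n k 0 i ;
  cl_total :
    (\sum_(0 <= n <oo) ((xip_tot n *m e) 0 0)%:E
     + \sum_(0 <= n <oo) ((gamp_tot n *m e) 0 0)%:E = 1)%E }.

End SteadyState.

End Queue.

(* Main.v *)
Require Import Defs.
From HB Require Import structures.
From mathcomp Require Import all_boot all_order all_algebra.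
From mathcomp Require Import all_classical all_reals all_analysis.
From mathcomp Require Import measurable_realfun ring lra zify.
Import Order.TTheory GRing.Theory Num.Theory.
Import numFieldNormedType.Exports.
Set Implicit Arguments.
Unset Strict Implicit.
Unset Printing Implicit Defensive.
Local Open Scope classical_set_scope.
Local Open Scope ring_scope.

(** Why the formula holds.

    Fix a batch size r < H.  A batch of that size takes all the waiting
    customers, so the queue behind it starts empty and the vectors
    x_n(u) = xi(n, r, u) solve the linear system
      - x_n' = x_n C + x_(n-1) D + s_r(u) F_n ,
    where only F_0 is non zero: it is the flow F into services of size r.  The
    transition matrices P_n(t) of the pair (number of arrivals, phase) solve
    the adjoint system P_n' = C P_n + D P_(n-1).  Hence the convolution
    sum_k x_(n-k)(u) P_k(u) has derivative - s_r(u) F P_n(u), and integrating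
    from 0 to T gives
      x_n(0) = sum_k x_(n-k)(T) P_k(T) + int_0^T s_r(u) F P_n(u) du
    ([backward_pairing]).  The entries of P_k(T) lie between 0 and 1 and those
    of x_k are non-negative and integrable, hence small at arbitrarily large T;
    letting T grow yields x_n(0) = F A_n^(r) ([service_transform]).

    It remains to pass from rates to probabilities at completion epochs.  Every
    density f satisfies (1/d) int_0^d f -> f(0), so all the limits defining
    xi^+ and gamma^+ are the values f(0) multiplied by the limit of
    d / P(completion before d) ([completion_proportional]).  That limit exists
    as soon as one value f(0) is non zero; if all of them vanished, no activity
    would ever be fed, uniqueness for the linear systems ([ode_zero]) would
    make all densities vanish, and the total mass would be 0.  For r > h the
    flow F is the sum of the gamma(r, k, 0) and xi(r, j, 0); for r = h one adds
    the flow out of the dormant state, and the balance equations of the dormant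
    states, solved one after the other, give the powers of (-C)^-1 D
    ([idle_closed_form]).

    The densities are only indefinite integrals, the service densities being
    merely measurable, so differentiating the convolution is replaced by an
    integration by parts for such functions ([integral_by_parts]).  That the
    P_k(T), which are defined by power series with terms of both signs, have
    entries in [0, 1] comes from [uniformization]: they equal exp(- theta T)
    times the analogous series for C + theta I, whose terms are non-negative. *)

(** * Integrable functions and integration by parts *)

Section Integrable.
Context d (T : measurableType d) (R : realType) (mu : {measure set T -> \bar R}).
Implicit Types (D : set T) (f g p : T -> R).

Lemma integrable_addr D f g : measurable D ->
  mu.-integrable D (EFin \o f) -> mu.-integrable D (EFin \o g) ->
  mu.-integrable D (EFin \o (fun x => f x + g x)).
Proof. by move=> mD fi gi; exact: eq_integrable mD _ _ _ (integrableD mD fi gi). Qed.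

Lemma integrable_scaler D (c : R) f : measurable D ->
  mu.-integrable D (EFin \o f) ->
  mu.-integrable D (EFin \o (fun x => c * f x)).
Proof. by move=> mD fi; exact: eq_integrable mD _ _ _ (integrableZl mD c fi). Qed.

Lemma integrable_subr D f g : measurable D ->
  mu.-integrable D (EFin \o f) -> mu.-integrable D (EFin \o g) ->
  mu.-integrable D (EFin \o (fun x => f x - g x)).
Proof. by move=> mD fi gi; exact: eq_integrable mD _ _ _ (integrableB mD fi gi). Qed.

Lemma integrable_sumr D (I : Type) (r : seq I) (P : pred I) (F : I -> T -> R) :
  measurable D -> (forall i, mu.-integrable D (EFin \o F i)) ->
  mu.-integrable D (EFin \o (fun x => \sum_(i <- r | P i) F i x)).
Proof.
move=> mD Fi.
have := integrable_sum mD r (P := P) (h := fun i => EFin \o F i) (fun i _ => Fi i).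
by apply: eq_integrable mD _ _ _ => x _ /=; rewrite sumEFin.
Qed.

Lemma Rintegral_sum D (I : Type) (r : seq I) (P : pred I) (F : I -> T -> R) :
  measurable D -> (forall i, mu.-integrable D (EFin \o F i)) ->
  \int[mu]_(x in D) (\sum_(i <- r | P i) F i x) =
  \sum_(i <- r | P i) \int[mu]_(x in D) F i x.
Proof.
move=> mD Fi; elim: r => [|a r IH].
  rewrite big_nil; under eq_Rintegral do rewrite big_nil.
  by rewrite Rintegral_cst// mul0r.
rewrite big_cons -IH; under eq_Rintegral do rewrite big_cons.
by case: ifP => // _; rewrite RintegralD//; exact: integrable_sumr.
Qed.

Lemma integrable_mul_bounded D f p (K : R) : measurable D ->
  measurable_fun D p -> (forall x, D x -> `|p x| <= K) ->
  mu.-integrable D (EFin \o f) ->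
  mu.-integrable D (EFin \o (fun x => f x * p x)).
Proof.
move=> mD mp pK fi.
have bp : [bounded p x | x in D].
  exists K; split; first exact: num_real.
  by move=> M KM x Dx /=; rewrite (le_trans (pK x Dx))// ltW.
by have := integrableMl mD fi mp bp.
Qed.

End Integrable.

Section RealAnalysis.
Variable R : realType.
Local Notation mu := (@lebesgue_measure R).
Implicit Types (f g p q : R -> R).

Lemma continuous_bounded_itv p (T : R) : continuous p ->
  exists2 K : R, 0 <= K & forall x : R, 0 <= x <= T -> `|p x| <= K.
Proof.
move=> cp; have cpt : compact (p @` `[0, T]).
  apply: continuous_compact; last exact: segment_compact.
  exact: continuous_subspaceT.
have [M [_ HM]] := compact_bounded cpt.
exists (`|M| + 1); first by rewrite addr_ge0.
move=> x xT; apply: (HM (`|M| + 1)).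
  by rewrite (le_lt_trans (ler_norm M))// ltrDl.
by exists x => //=; rewrite in_itv/= xT.
Qed.

Lemma Rintegral_chasles f (a b c : R) : a <= b -> b <= c ->
  mu.-integrable `[a, c] (EFin \o f) ->
  \int[mu]_(t in `[a, c]) f t =
  \int[mu]_(t in `[a, b]) f t + \int[mu]_(t in `[b, c]) f t.
Proof.
move=> ab bc fi.
have := Rintegral_itvB fi (x := b); rewrite !bnd_simp => /(_ ab bc).
rewrite Rintegral_itv_obnd_cbnd; last first.
  apply: integrableS fi => //; apply: subset_itv; rewrite bnd_simp//.
by move=> <-; rewrite addrC subrK.
Qed.

Lemma Rintegral_cst_itv (c u w : R) : u <= w ->
  \int[mu]_(t in `[u, w]) c = c * (w - u).
Proof.
move=> uw; rewrite Rintegral_cst; last exact: measurable_itv.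
congr (_ * _); transitivity (fine (mu [set` `[u, w]])) => //.
rewrite lebesgue_measure_itv/= lte_fin; case: ltP => //= wu.
by have -> : u = w; [apply/eqP; rewrite eq_le uw wu|rewrite subrr].
Qed.

(** Cutting [0, T] into N equal pieces bounds the total increment of F by
    (L T / N) (G T - G 0).  This form of the principle that a function with zero
    derivative is constant only asks G to be a function, so it applies to
    increments controlled by the integral of an unbounded function. *)
Lemma cst_of_increment_bound (T L : R) (F G : R -> R) : 0 <= T -> 0 <= L ->
  (forall u w : R, 0 <= u -> u <= w -> w <= T ->
     `|F w - F u| <= L * (w - u) * (G w - G u)) ->
  F T = F 0.
Proof.
move=> T0 L0 FG.
have part N : `|F T - F 0| <= (L * T * (G T - G 0)) / N.+1%:R.
  pose d := T / N.+1%:R.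
  have d0 : 0 <= d by rewrite divr_ge0.
  have Nd : d *+ N.+1 = T by rewrite /d -mulr_natr divfK.
  have step k : (k <= N.+1)%N ->
      `|F (d *+ k) - F 0| <= L * d * (G (d *+ k) - G 0).
    elim: k => [|k IH kN]; first by rewrite mulr0n !subrr normr0 mulr0.
    have -> : F (d *+ k.+1) - F 0 =
        (F (d *+ k.+1) - F (d *+ k)) + (F (d *+ k) - F 0) by ring.
    rewrite (le_trans (ler_normD _ _))//.
    have -> : L * d * (G (d *+ k.+1) - G 0) =
      L * (d *+ k.+1 - d *+ k) * (G (d *+ k.+1) - G (d *+ k)) +
      L * d * (G (d *+ k) - G 0) by rewrite mulrS; ring.
    rewrite lerD//; last by rewrite IH// ltnW.
    apply: FG.
    - by rewrite mulrn_wge0.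
    - by rewrite mulrS lerDr.
    - by rewrite -Nd ler_wpMn2l.
  have := step N.+1 (leqnn _); rewrite Nd => /le_trans; apply.
  by rewrite /d mulrA [X in X <= _]mulrAC.
have lim0 : (L * T * (G T - G 0)) / N.+1%:R @[N --> \oo] --> (0 : R).
  rewrite -[X in _ --> X](mulr0 (L * T * (G T - G 0))).
  by apply: cvgMr; exact: cvg_harmonic.
have : `|F T - F 0| <= 0.
  apply: (cvgr_to_ge lim0); by near=> N; exact: part.
by rewrite normr_le0 subr_eq0 => /eqP.
Unshelve. all: end_near. Qed.

Lemma integral_primitive_continuous f g (T : R) : 0 <= T ->
  (forall u w : R, 0 <= u -> u <= w -> f u - f w = \int[mu]_(t in `[u, w]) g t) ->
  mu.-integrable `[0, T] (EFin \o g) ->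
  {within `[0, T], continuous f}.
Proof.
move=> T0 fg gi.
have cG := parameterized_integral_continuous T0 gi.
pose G x := parameterized_integral mu 0 x g.
have cH : {within `[0, T], continuous (fun x => f 0 - G x)}.
  by move=> x; apply: continuousB; [exact: cvg_cst|exact: cG].
move=> x; apply: (subspace_eq_continuous (f := fun x => f 0 - G x)) => //.
move=> y; rewrite inE /= in_itv/= => /andP[y0 yT].
by rewrite /G /parameterized_integral -fg// opprB addrC subrK.
Qed.

Lemma FTC_is_derive p q (u w : R) : u <= w ->
  (forall t : R, is_derive t (1 : R) p (q t)) -> continuous q ->
  p w - p u = \int[mu]_(t in `[u, w]) q t.
Proof.
rewrite le_eqVlt => /predU1P[<- _ _|uw dp cq].
  by rewrite subrr set_itv1 Rintegral_set1.
have cp : continuous p.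
  by move=> t; apply: differentiable_continuous; apply/derivable1_diffP; exact: ex_derive.
rewrite /Rintegral (continuous_FTC2 (F := p) uw).
- by rewrite -EFinB.
- exact: continuous_subspaceT.
- split.
  + by move=> x _; exact: ex_derive.
  + by apply: cvg_at_right_filter; exact: cp.
  + by apply: cvg_at_left_filter; exact: cp.
- by move=> x _; rewrite derive1E; exact: derive_val.
Qed.

(** The function f need not be differentiable anywhere.  The increment over [u, w]
    of f p plus the integral of the right-hand side is of second order, namely
    at most 2 K (w - u) times the integral of |g| over [u, w], where K bounds
    the derivative of p; hence there is no increment at all. *)
Lemma integral_by_parts f g p q (T : R) : 0 <= T ->
  (forall u w : R, 0 <= u -> u <= w -> f u - f w = \int[mu]_(t in `[u, w]) g t) ->
  mu.-integrable `[0, T] (EFin \o g) ->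
  (forall t : R, is_derive t (1 : R) p (q t)) -> continuous q ->
  f 0 * p 0 - f T * p T = \int[mu]_(t in `[0, T]) (g t * p t - f t * q t).
Proof.
move=> T0 fg gi dp cq.
have cp : continuous p.
  by move=> t; apply: differentiable_continuous; apply/derivable1_diffP; exact: ex_derive.
have [K K0 qK] := continuous_bounded_itv T cq.
have [Kp Kp0 pK] := continuous_bounded_itv T cp.
have cf := integral_primitive_continuous T0 fg gi.
have fi : mu.-integrable `[0, T] (EFin \o f).
  by apply: continuous_compact_integrable => //; exact: segment_compact.
have mp : measurable_fun (`[0, T]%classic : set (measurableTypeR R)) p.
  by apply: measurable_funTS; exact: continuous_measurable_fun.
have mq : measurable_fun (`[0, T]%classic : set (measurableTypeR R)) q.
  by apply: measurable_funTS; exact: continuous_measurable_fun.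
have gpi : mu.-integrable `[0, T] (EFin \o (fun t => g t * p t)).
  apply: (integrable_mul_bounded (K := Kp) _ mp _ gi) => [|x]; first exact: measurable_itv.
  by rewrite /= in_itv/=; exact: pK.
have fqi : mu.-integrable `[0, T] (EFin \o (fun t => f t * q t)).
  apply: (integrable_mul_bounded (K := K) _ mq _ fi) => [|x]; first exact: measurable_itv.
  by rewrite /= in_itv/=; exact: qK.
pose J t := g t * p t - f t * q t.
have Ji : mu.-integrable `[0, T] (EFin \o J) by exact: integrable_subr.
have gn : mu.-integrable `[0, T] (EFin \o (fun t => `|g t|)) by exact: integrable_norm.
have sub u w : 0 <= u -> w <= T -> `[u, w] `<=` `[0, T].
  by move=> u0 wT; apply: subset_itv; rewrite bnd_simp.
pose F u := f u * p u + \int[mu]_(t in `[0, u]) J t.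
pose G u := \int[mu]_(t in `[0, u]) `|g t|.
have GE u w : 0 <= u -> u <= w -> w <= T ->
    G w - G u = \int[mu]_(t in `[u, w]) `|g t|.
  move=> u0 uw wT; rewrite /G (@Rintegral_chasles _ 0 u w)//; first by ring.
  by apply: integrableS gn => //; exact: sub.
have main : F T = F 0.
  apply: (@cst_of_increment_bound T (K + K) F G) => //; first by rewrite addr_ge0.
  move=> u w u0 uw wT.
  have uT := le_trans uw wT.
  have w0 := le_trans u0 uw.
  have qi : mu.-integrable `[0, T] (EFin \o q).
    apply: continuous_compact_integrable => //; last exact: continuous_subspaceT.
    exact: segment_compact.
  have IS h : mu.-integrable `[0, T] (EFin \o h) ->
      mu.-integrable `[u, w] (EFin \o h).
    by move=> hi; apply: integrableS hi => //; exact: sub.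
  have gw : mu.-integrable `[u, w] (EFin \o (fun t => g t * p w)).
    apply: eq_integrable (integrable_scaler (p w) _ (IS _ gi)) => //.
    by move=> t _ /=; rewrite mulrC.
  (* the error committed by freezing p at w and f at u on [u, w] *)
  pose E t := g t * (p w - p t) + (f t - f u) * q t.
  have Ei : mu.-integrable `[u, w] (EFin \o E).
    apply: eq_integrable (integrable_subr _ (integrable_subr _ gw (IS _ gpi))
      (integrable_subr _ (integrable_scaler (f u) _ (IS _ qi)) (IS _ fqi))) => //.
    by move=> t _ /=; congr EFin; rewrite /E; ring.
  have -> : F w - F u = - \int[mu]_(t in `[u, w]) E t.
    have -> : F w - F u = f w * p w - f u * p u + \int[mu]_(t in `[u, w]) J t.
      rewrite /F (@Rintegral_chasles J 0 u w)//; first by ring.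
      by apply: integrableS Ji => //; exact: sub.
    have -> : f w * p w - f u * p u =
        f u * (p w - p u) - (f u - f w) * p w by ring.
    have -> : p w - p u = \int[mu]_(t in `[u, w]) q t.
      exact: FTC_is_derive.
    rewrite fg// -RintegralZl//; last exact: IS.
    rewrite -RintegralZr//; last exact: IS.
    rewrite -RintegralB//; last exact: integrable_scaler (IS _ qi).
    rewrite -RintegralD//; last 2 first.
    - by apply: integrable_subr => //; exact: integrable_scaler (IS _ qi).
    - exact: IS.
    rewrite -mulN1r -RintegralZl//.
    by apply: eq_Rintegral => t _; rewrite /J /E; ring.
  rewrite normrN.
  have -> : (K + K) * (w - u) * (G w - G u) =
      \int[mu]_(t in `[u, w]) (K * (w - u) * `|g t|) +
      \int[mu]_(t in `[u, w]) (K * (G w - G u)).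
    rewrite RintegralZl//; last exact: IS.
    by rewrite -GE// Rintegral_cst_itv//; ring.
  have ci : mu.-integrable `[u, w] (EFin \o (fun=> K * (G w - G u))).
    by apply: continuous_compact_integrable; [exact: segment_compact|move=> ?; exact: cvg_cst].
  rewrite (le_trans (le_normr_Rintegral _ Ei))//.
  rewrite -RintegralD//; last exact: integrable_scaler (IS _ gn).
  apply: le_Rintegral => //.
  - exact: integrable_norm.
  - by apply: integrable_addr => //; exact: integrable_scaler (IS _ gn).
  move=> t; rewrite /= in_itv/= => /andP[ut tw].
  have t0 := le_trans u0 ut; have tT := le_trans tw wT.
  rewrite (le_trans (ler_normD _ _))// lerD//.
    rewrite normrM mulrC ler_wpM2r//.
    have [c] := MVT_segment tw (fun x _ => dp x) (continuous_subspaceT cp).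
    rewrite in_itv/= => /andP[tc cw] ->.
    rewrite normrM ler_pM//; first by rewrite qK// (le_trans t0 tc) (le_trans cw).
    by rewrite ger0_norm ?subr_ge0// lerB.
  rewrite normrM mulrC ler_pM//; first by rewrite qK// t0.
  rewrite distrC fg// (le_trans (le_normr_Rintegral _ _))//.
    by apply: integrableS gi => //; exact: sub.
  by rewrite -GE// lerB// -subr_ge0 GE// Rintegral_ge0.
have := main; rewrite /F.
have -> : \int[mu]_(t in `[0, 0]) J t = 0 by rewrite set_itv1 Rintegral_set1.
by rewrite addr0 => <-; rewrite addrAC subrr add0r.
Qed.
End RealAnalysis.

(** * Integrals over the half-line *)

Section HalfLine.
Variable R : realType.
Local Notation mu := (@lebesgue_measure R).
Local Notation Rp := (`[0, +oo[%classic : set R).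
Implicit Types (f g y : R -> R).

Lemma subset_itv0_half (T : R) : `[0, T]%classic `<=` Rp.
Proof. by move=> x /=; rewrite !in_itv/= => /andP[->]. Qed.

Lemma integrable_itv0 f (T : R) : mu.-integrable Rp (EFin \o f) ->
  mu.-integrable `[0, T] (EFin \o f).
Proof. by apply: integrableS => //; exact: subset_itv0_half. Qed.

Lemma average_cvg_at0 f g :
  (forall u w : R, 0 <= u -> u <= w -> f u - f w = \int[mu]_(t in `[u, w]) g t) ->
  mu.-integrable Rp (EFin \o g) ->
  (\int[mu]_(u in `[0, d]) f u) / d @[d --> 0^'+] --> f 0.
Proof.
move=> fg gi.
have := @parameterized_integral_cvg_left _ 0 1 g ltr01 (integrable_itv0 1 gi).
move=> /cvgrPdist_le g0; apply/cvgrPdist_le => e e0.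
have {g0} := g0 e e0; rewrite nearE => /nbhs_ballP[r /= r0 gr].
near=> d.
have d0 : 0 < d by [].
have dr : d < r by near: d; exact: nbhs_right_lt.
have fd : mu.-integrable `[0, d] (EFin \o f).
  apply: continuous_compact_integrable; first exact: segment_compact.
  exact: (integral_primitive_continuous (ltW d0) fg (integrable_itv0 d gi)).
have -> : f 0 - (\int[mu]_(u in `[0, d]) f u) / d =
    (\int[mu]_(u in `[0, d]) (f 0 - f u)) / d.
  rewrite RintegralB//; last first.
    by apply: continuous_compact_integrable; [exact: segment_compact|move=> ?; exact: cvg_cst].
  rewrite Rintegral_cst_itv ?ltW// mulrBl subr0 mulfK ?gt_eqF//.
have fdi : mu.-integrable `[0, d] (EFin \o (fun u => f 0 - f u)).
  apply: integrable_subr => //.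
  by apply: continuous_compact_integrable; [exact: segment_compact|move=> ?; exact: cvg_cst].
rewrite normrM normfV (gtr0_norm d0) ler_pdivrMr//.
rewrite (le_trans (le_normr_Rintegral _ fdi))//.
have -> : e * d = \int[mu]_(u in `[0, d]) e.
  by rewrite Rintegral_cst_itv ?ltW// subr0.
apply: le_Rintegral => //.
- exact: integrable_norm.
- by apply: continuous_compact_integrable; [exact: segment_compact|move=> ?; exact: cvg_cst].
move=> u; rewrite /= in_itv/= => /andP[u0 ud].
rewrite fg//.
have := gr u; rewrite sub0r normrN; apply.
by rewrite /ball/= sub0r normrN ger0_norm// (le_lt_trans ud).
Unshelve. all: end_near. Qed.

Lemma Rintegral_cvg_half_line f (T : nat -> R) :
  (forall N, N%:R <= T N) -> mu.-integrable Rp (EFin \o f) ->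
  (\int[mu]_(t in `[0, T N]) f t) @[N --> \oo] --> \int[mu]_(t in Rp) f t.
Proof.
move=> TN fi.
have mRp : measurable (Rp : set (measurableTypeR R)) by exact: measurable_itv.
have mT N : measurable (`[0, T N]%classic : set (measurableTypeR R)).
  exact: measurable_itv.
pose F (N : nat) := (EFin \o f) \_ `[0, T N].
have Fi N : (\int[mu]_(t in Rp) F N t)%E = (\int[mu]_(t in `[0%R, T N]) (f t)%:E)%E.
  rewrite /F -integral_mkcondr; congr integral.
  by rewrite setIidr//; exact: subset_itv0_half.
have mF N : measurable_fun Rp (F N).
  apply/(measurable_restrict _ (mT N) mRp).
  apply: measurable_funS mRp _ (measurable_int _ fi).
  exact: subIsetl.
have cvF : {ae mu, forall x, Rp x -> F ^~ x @ \oo --> (EFin \o f) x}.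
  apply: aeW => x /=; rewrite in_itv/= andbT => x0.
  apply: cvg_near_cst; near=> N.
  rewrite /F patchE ifT// inE/= in_itv/= x0/= (le_trans _ (TN N))//.
  by apply: ltW; near: N; exact: nbhs_infty_gtr.
have domF : {ae mu, forall x N, Rp x -> (`|F N x| <= (abse \o (EFin \o f)) x)%E}.
  apply: aeW => x N _; rewrite /F patchE; case: ifP => // _.
  by rewrite abse0 abse_ge0.
have [_ _] := dominated_convergence mRp mF (measurable_int _ fi) cvF
  (integrable_abse fi) domF.
move=> cv; apply: fine_cvg.
rewrite fineK; last exact: integrable_fin_num.
by apply: cvg_trans cv; apply: near_eq_cvg; near=> N; rewrite /= Fi.
Unshelve. all: end_near. Qed.

(** An integrable function need not tend to 0 at infinity, but it cannot stay
    above e on a half-line. *)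
Lemma integrable_takes_small_values y (e N : R) : 0 < e -> 0 <= N ->
  (forall t, 0 <= t -> 0 <= y t) -> mu.-integrable Rp (EFin \o y) ->
  exists2 T, N <= T & y T < e.
Proof.
move=> e0 N0 y0 yi; apply: contrapT => small.
have big t : N <= t -> e <= y t.
  by move=> Nt; rewrite leNgt; apply/negP => yt; apply: small; exists t.
have bound (K : nat) : e * K%:R <= \int[mu]_(t in Rp) y t.
  have yNK : mu.-integrable `[N, N + K%:R] (EFin \o y).
    apply: integrableS (integrable_itv0 (N + K%:R) yi) => //.
    by apply: subset_itv; rewrite bnd_simp.
  apply: (@le_trans _ _ (\int[mu]_(t in `[N, N + K%:R]) y t)).
    have -> : e * K%:R = \int[mu]_(t in `[N, N + K%:R]) e.
      by rewrite Rintegral_cst_itv ?lerDl// addrAC subrr add0r.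
    apply: le_Rintegral => //.
    by apply: continuous_compact_integrable; [exact: segment_compact|move=> ?; exact: cvg_cst].
    by move=> t; rewrite /= in_itv/= => /andP[Nt _]; exact: big.
  rewrite -lee_fin !fineK; [|exact: integrable_fin_num..].
  apply: ge0_subset_integral => //.
  - by apply: (measurable_int _ yi).
  - by move=> t; rewrite /= in_itv/= andbT lee_fin; exact: y0.
  - by apply: subset_itv; rewrite bnd_simp.
have /archi_boundP : 0 <= (\int[mu]_(t in Rp) y t) / e.
  apply: divr_ge0; last exact: ltW.
  by apply: Rintegral_ge0 => t; rewrite /= in_itv/= andbT; exact: y0.
by rewrite ltr_pdivrMr// mulrC ltNge bound.
Qed.

End HalfLine.

(** * Exponential generating functions *)

Section Egf.
Variable R : realType.
Implicit Types (a b : nat -> R) (t x : R).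

(** Exponential generating function of the sequence a.  Differentiating it shifts
    the sequence, so a linear recurrence for a becomes a linear differential
    equation. *)
Definition egf a t : R := limn (pseries (fun k => a k / k`!%:R) t).

Definition geometric_growth a : Prop :=
  exists A M : R, [/\ 0 <= A, 0 <= M & forall k, `|a k| <= A * M ^+ k].

Lemma geometric_growthS a : geometric_growth a ->
  geometric_growth (fun k => a k.+1).
Proof.
move=> [A [M [A0 M0 aM]]]; exists (A * M), M; split => //.
  by rewrite mulr_ge0.
by move=> k; rewrite -mulrA -exprS.
Qed.

Lemma geometric_growth_sum (I : Type) (r : seq I) (c : I -> R)
    (f : I -> nat -> R) : (forall i, geometric_growth (f i)) ->
  geometric_growth (fun k => \sum_(i <- r) c i * f i k).
Proof.
move=> gf; elim: r => [|i r [A [M [A0 M0 IH]]]].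
  by exists 0, 0; split => // k; rewrite big_nil normr0 mul0r.
have [B [N [B0 N0 fB]]] := gf i.
exists (`|c i| * B + A), (N + M); split => [| |k].
- by rewrite addr_ge0// mulr_ge0.
- by rewrite addr_ge0.
rewrite big_cons mulrDl (le_trans (ler_normD _ _))// lerD//.
  rewrite normrM -mulrA ler_wpM2l// (le_trans (fB k))// ler_wpM2l//.
  by rewrite lerXn2r ?nnegrE ?addr_ge0// lerDl.
by rewrite (le_trans (IH k))// ler_wpM2l// lerXn2r ?nnegrE ?addr_ge0// lerDr.
Qed.

Lemma egf_term_le a A M t : (forall k, `|a k| <= A * M ^+ k) -> 0 <= M ->
  forall k, `|a k / k`!%:R * t ^+ k| <= A * exp_coeff (M * `|t|) k.
Proof.
move=> aM M0 k.
have -> : `|a k / k`!%:R * t ^+ k| = `|a k| * (`|t| ^+ k / k`!%:R).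
  by rewrite !normrM normrX normfV normr_nat -!mulrA; congr (_ * _); exact: mulrC.
have -> : A * exp_coeff (M * `|t|) k = A * M ^+ k * (`|t| ^+ k / k`!%:R).
  by rewrite /exp_coeff/= exprMn !mulrA.
by apply: ler_wpM2r => //; rewrite divr_ge0// exprn_ge0.
Qed.

Lemma is_cvg_series_scaled_exp A x : cvgn (series (fun k => A * exp_coeff x k)).
Proof.
exact/is_cvg_seriesZ/is_cvg_series_exp_coeff.
Qed.

Lemma cvg_egf a t : geometric_growth a ->
  cvgn (pseries (fun k => a k / k`!%:R) t).
Proof.
move=> [A [M [A0 M0 aM]]]; apply: normed_cvg.
apply: (series_le_cvg (v_ := fun k => A * exp_coeff (M * `|t|) k)) => //.
- by move=> k; exact: normr_ge0.
- by move=> k; apply: mulr_ge0 => //; apply: exp_coeff_ge0; exact: mulr_ge0.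
- by move=> k; exact: egf_term_le.
- exact: is_cvg_series_scaled_exp.
Qed.

Lemma is_derive_egf a t : geometric_growth a ->
  is_derive t (1 : R) (egf a) (egf (fun k => a k.+1) t).
Proof.
move=> ga.
have diffs b : pseries_diffs (fun k => b k / k`!%:R) = (fun k => b k.+1 / k`!%:R).
  apply/funext => k; rewrite /pseries_diffs factS natrM invfM.
  by rewrite mulrCA mulVKf// mulrC.
have tK : `|t| < `| `|t| + 1 | by rewrite [ltRHS]ger0_norm ?addr_ge0// ltrDl.
have := @pseries_snd_diffs R (fun k => a k / k`!%:R) (`|t| + 1) t.
rewrite (diffs a) (diffs (fun k => a k.+1)); apply => //; apply: cvg_egf => //.
  exact: (geometric_growthS ga).
exact: (geometric_growthS (geometric_growthS ga)).
Qed.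

Lemma egf0 a : egf a 0 = a 0%N.
Proof.
rewrite /egf; apply: cvg_lim => //.
apply: cvg_near_cst; near=> n.
have n0 : (0 < n)%N by near: n; exact: nbhs_infty_gt.
rewrite /pseries/= /series/= -(prednK n0) big_nat_recl//= big1 => [|i _].
  by rewrite expr0 fact0 invr1 !mulr1 addr0.
by rewrite exprS mul0r mulr0.
Unshelve. all: end_near. Qed.

Lemma egf_linear (I : Type) (r : seq I) (c : I -> R) (f : I -> nat -> R) t :
  (forall i, geometric_growth (f i)) ->
  egf (fun k => \sum_(i <- r) c i * f i k) t = \sum_(i <- r) c i * egf (f i) t.
Proof.
move=> gf; rewrite /egf; apply: cvg_lim => //.
have -> : pseries (fun k => (\sum_(i <- r) c i * f i k) / k`!%:R) t =
  (fun n => \sum_(i <- r) c i * pseries (fun k => f i k / k`!%:R) t n).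
  apply/funext => n; rewrite /pseries/= /series/=.
  under [in RHS]eq_bigr do rewrite mulr_sumr.
  rewrite exchange_big/=; apply: eq_bigr => k _.
  by rewrite mulr_suml mulr_suml; apply: eq_bigr => i _; rewrite !mulrA.
by apply: cvg_big => [|i _]; [exact: add_continuous|apply: cvgMr; exact: cvg_egf].
Qed.

Lemma egf_linear2 (I : Type) (r : seq I) (c d : I -> R) (f g : I -> nat -> R) t :
  (forall i, geometric_growth (f i)) -> (forall i, geometric_growth (g i)) ->
  egf (fun k => \sum_(i <- r) c i * f i k + \sum_(i <- r) d i * g i k) t =
  \sum_(i <- r) c i * egf (f i) t + \sum_(i <- r) d i * egf (g i) t.
Proof.
move=> gf gg; rewrite -!egf_linear// /egf -limD; last 2 first.
- exact/cvg_egf/geometric_growth_sum.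
- exact/cvg_egf/geometric_growth_sum.
congr (limn _); apply/funext => n; rewrite fctE /pseries /series/= -big_split/=.
by apply: eq_bigr => k _; rewrite -!mulrDl.
Qed.

Lemma egf_le a A M t : (forall k, `|a k| <= A * M ^+ k) -> 0 <= M -> 0 <= A ->
  `|egf a t| <= A * expR (M * `|t|).
Proof.
move=> aM M0 A0.
have ga : geometric_growth a by exists A, M.
have cn : cvgn [normed pseries (fun k => a k / k`!%:R) t].
  apply: (series_le_cvg (v_ := fun k => A * exp_coeff (M * `|t|) k)) => //.
  - by move=> k; exact: normr_ge0.
  - by move=> k; apply: mulr_ge0 => //; apply: exp_coeff_ge0; exact: mulr_ge0.
  - by move=> k; exact: egf_term_le.
  - exact: is_cvg_series_scaled_exp.
apply: le_trans (lim_series_norm cn) _.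
have -> : A * expR (M * `|t|) = limn (series (fun k => A * exp_coeff (M * `|t|) k)).
  exact/esym/lim_seriesZ/is_cvg_series_exp_coeff.
apply: lim_series_le => //; first exact: is_cvg_series_scaled_exp.
by move=> k; exact: egf_term_le.
Qed.

Lemma egf_ge0 a t : geometric_growth a -> (forall k, 0 <= a k) -> 0 <= t ->
  0 <= egf a t.
Proof.
move=> ga a0 t0; apply: limr_ge; first exact: cvg_egf.
by near=> n; rewrite /pseries/= /series/= sumr_ge0// => k _; rewrite mulr_ge0 ?exprn_ge0// divr_ge0.
Unshelve. all: end_near. Qed.

End Egf.

(** * The counting process of arrivals *)

(** The index n counts arrivals: the convention that the term of index -1 is 0
    lets the equations at level 0 and at the positive levels be written once. *)
Definition prev (V : nmodType) (F : nat -> V) (n : nat) : V :=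
  if n is n'.+1 then F n' else 0.

(** The source of an activity that begins with no arrival counted yet, such as a
    vacation, or a service taking all the waiting customers. *)
Definition initial (V : nmodType) (x : V) (n : nat) : V := if n is 0%N then x else 0.

Section Counting.
Variables (R : realType) (m : nat).
Implicit Types (C D : 'M[R]_m) (M t : R).

Lemma jump_mx0 C D l : jump_mx C D 0 l = if l is 0%N then 1%:M else 0.
Proof.
apply/matrixP => i j; rewrite mxE expr0.
have -> : (1 : 'M[{poly R}]_m) i j = (i == j)%:R by rewrite mxE.
by rewrite -polyC_natr coefC; case: l => [|l] /=; rewrite !mxE.
Qed.

Lemma jump_mxS C D k l :
  jump_mx C D k.+1 l = C *m jump_mx C D k l + D *m prev (jump_mx C D k) l.
Proof.
apply/matrixP => i j; rewrite !mxE exprS mxE coef_sum -big_split/=.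
apply: eq_bigr => a _; rewrite !mxE mulrDl coefD coefCM; congr (_ + _).
rewrite -mulrA coefXM; case: l => [|l] /=; first by rewrite mxE mulr0.
by rewrite coefCM mxE.
Qed.

Lemma jump_mxSr C D k l :
  jump_mx C D k.+1 l = jump_mx C D k l *m C + prev (jump_mx C D k) l *m D.
Proof.
apply/matrixP => i j; rewrite !mxE exprSr mxE coef_sum -big_split/=.
apply: eq_bigr => a _; rewrite !mxE mulrDr coefD coefMC; congr (_ + _).
rewrite [in LHS](mulrC 'X) mulrA coefMX; case: l => [|l] /=; first by rewrite mxE mul0r.
by rewrite coefMC mxE.
Qed.

(** M is left free because the bound on transition probabilities needs it to be
    the uniformization rate itself, not just some constant. *)
Lemma jump_mx_le C D M : (forall i, \sum_a (`|C i a| + `|D i a|) <= M) ->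
  forall k l i j, `|jump_mx C D k l i j| <= M ^+ k.
Proof.
move=> HM k l i j.
have M0 : 0 <= M by apply: le_trans (HM i); apply: sumr_ge0 => a _; rewrite addr_ge0.
elim: k l i j => [|k IH] l i j.
  rewrite expr0 jump_mx0; case: l => [|l]; rewrite mxE ?normr0//.
  by case: eqP => _; rewrite ?normr1 ?normr0.
rewrite jump_mxS !mxE -big_split/= (le_trans (ler_norm_sum _ _ _))//.
rewrite exprS (le_trans _ (ler_wpM2r _ (HM i))) ?exprn_ge0// mulr_suml.
apply: ler_sum => a _; rewrite (le_trans (ler_normD _ _))// mulrDl !normrM lerD//.
  by rewrite ler_wpM2l.
rewrite ler_wpM2l//; case: l => [|l] /=; last exact: IH.
by rewrite mxE normr0 exprn_ge0.
Qed.

Lemma jump_mx_ge0 C D : (forall i j, 0 <= C i j) -> (forall i j, 0 <= D i j) ->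
  forall k l i j, 0 <= jump_mx C D k l i j.
Proof.
move=> C0 D0; elim => [|k IH] l i j.
  by rewrite jump_mx0; case: l => [|l]; rewrite mxE ?ler0n.
rewrite jump_mxS !mxE; apply: addr_ge0; apply: sumr_ge0 => a _; apply: mulr_ge0 => //.
by case: l => [|l] //=; rewrite mxE.
Qed.

Lemma jump_mx_growth C D l i j : geometric_growth (fun k => jump_mx C D k l i j).
Proof.
pose M := \sum_i \sum_a (`|C i a| + `|D i a|).
exists 1, M; split => //.
  by apply: sumr_ge0 => a _; apply: sumr_ge0 => b _; rewrite addr_ge0.
move=> k; rewrite mul1r; apply: jump_mx_le => b.
rewrite /M [X in _ <= X](bigD1 b)//= lerDl.
by apply: sumr_ge0 => a _; apply: sumr_ge0 => c _; rewrite addr_ge0.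
Qed.

Lemma count_mxE C D l t i j :
  count_mx C D l t i j = egf (fun k => jump_mx C D k l i j) t.
Proof.
rewrite mxE /egf /pseries; congr (limn (series _)); apply/funext => k /=.
by rewrite mulrC mulrA mulrAC.
Qed.

Lemma count_mx0 C D l : count_mx C D l 0 = if l is 0%N then 1%:M else 0.
Proof. by apply/matrixP => i j; rewrite count_mxE egf0 jump_mx0. Qed.

Lemma prev_growth C D l i j : geometric_growth (fun k => prev (jump_mx C D k) l i j).
Proof.
case: l => [|l] /=; last exact: jump_mx_growth.
by exists 0, 0; split => // k; rewrite mxE normr0 mul0r.
Qed.

Lemma egf_prev C D l t i j :
  egf (fun k => prev (jump_mx C D k) l i j) t =
  prev (fun l => count_mx C D l t) l i j.
Proof.
case: l => [|l] /=; last by rewrite count_mxE.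
rewrite mxE; apply/eqP; rewrite -normr_le0.
rewrite -[leRHS](mul0r (expR (0 * `|t|))).
by apply: egf_le => // k; rewrite normr0 mul0r.
Qed.

Lemma egf_jumpS C D l t i j : egf (fun k => jump_mx C D k.+1 l i j) t =
  (C *m count_mx C D l t + D *m prev (fun l => count_mx C D l t) l) i j.
Proof.
under eq_fun do rewrite jump_mxS mxE !mxE.
rewrite egf_linear2; first last.
- by move=> a; exact: prev_growth.
- by move=> a; exact: jump_mx_growth.
rewrite !mxE; congr (_ + _); apply: eq_bigr => a _.
  by rewrite count_mxE.
by rewrite egf_prev.
Qed.

Lemma egf_jumpSr C D l t i j : egf (fun k => jump_mx C D k.+1 l i j) t =
  (count_mx C D l t *m C + prev (fun l => count_mx C D l t) l *m D) i j.
Proof.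
have -> : (fun k => jump_mx C D k.+1 l i j) =
    (fun k => \sum_a C a j * jump_mx C D k l i a +
              \sum_a D a j * prev (jump_mx C D k) l i a).
  apply/funext => k; rewrite jump_mxSr mxE !mxE.
  by congr (_ + _); apply: eq_bigr => a _; exact: mulrC.
rewrite egf_linear2; first last.
- by move=> a; exact: prev_growth.
- by move=> a; exact: jump_mx_growth.
rewrite !mxE; congr (_ + _); apply: eq_bigr => a _; rewrite mulrC.
  by rewrite count_mxE.
by rewrite egf_prev.
Qed.

Lemma is_derive_count_mx C D l i j t :
  is_derive t (1 : R) (fun t => count_mx C D l t i j)
    ((C *m count_mx C D l t + D *m prev (fun l => count_mx C D l t) l) i j).
Proof.
have -> : (fun t => count_mx C D l t i j) = egf (fun k => jump_mx C D k l i j).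
  by apply/funext => u; rewrite count_mxE.
rewrite -egf_jumpS; exact/is_derive_egf/jump_mx_growth.
Qed.

(** Kolmogorov backward and forward equations have the same right-hand side,
    because the generator commutes with its own powers. *)
Lemma count_mx_comm C D l t :
  C *m count_mx C D l t + D *m prev (fun l => count_mx C D l t) l =
  count_mx C D l t *m C + prev (fun l => count_mx C D l t) l *m D.
Proof. by apply/matrixP => i j; rewrite -egf_jumpS egf_jumpSr. Qed.

Lemma count_mx_continuous C D l i j : continuous (fun t => count_mx C D l t i j).
Proof.
move=> t; apply: differentiable_continuous; apply/derivable1_diffP.
by have [] := is_derive_count_mx C D l i j t.
Qed.

End Counting.

(** * Pairing of adjoint linear systems *)

Lemma integrable_mulmx d (T : measurableType d) (R : realType)
    (mu : {measure set T -> \bar R}) (X : set T) m n (f : T -> 'rV[R]_m)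
    (A : 'M[R]_(m, n)) a : measurable X ->
  (forall c, mu.-integrable X (EFin \o (fun u => f u 0 c))) ->
  mu.-integrable X (EFin \o (fun u => (f u *m A) 0 a)).
Proof.
move=> mX fi; have := @integrable_sumr _ _ _ mu X _ (index_enum 'I_m) predT
  (fun c u => A c a * f u 0 c) mX (fun c => integrable_scaler (A c a) mX (fi c)).
apply: eq_integrable => // u _ /=; congr EFin; rewrite mxE.
by apply: eq_bigr => c _; exact: mulrC.
Qed.

Section Pairing.
Variables (R : realType) (m : nat).
Local Notation mu := (@lebesgue_measure R).
Variables C D : 'M[R]_m.

(** Multiplication by D raises the level by one in x or in p alike: the two
    convolutions with one factor D agree after reindexing. *)
Lemma convolution_cancel (x b : nat -> 'rV[R]_m) (p : nat -> 'M[R]_m) n :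
  \sum_(k < n.+1) ((x (n - k)%N *m C + prev x (n - k) *m D + b (n - k)%N) *m p k
     - x (n - k)%N *m (C *m p k + D *m prev p k)) =
  \sum_(k < n.+1) b (n - k)%N *m p k.
Proof.
have shift : \sum_(k < n.+1) prev x (n - k) *m D *m p k -
    \sum_(k < n.+1) x (n - k)%N *m D *m prev p k = 0.
  rewrite big_ord_recr [X in _ - X]big_ord_recl/= subnn/= !mul0mx mulmx0 addr0 add0r.
  rewrite -sumrB big1// => k _.
  have -> : (n - k = (n - bump 0 k).+1)%N by rewrite /bump/= add1n subnSK.
  by rewrite /= subrr.
rewrite -[RHS]addr0 -[X in _ = _ + X]shift -sumrB -big_split/=; apply: eq_bigr => k _.
by rewrite !mulmxDl mulmxDr !mulmxA opprD addrACA [X in X + _]addrAC subrr add0r addrCA.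
Qed.

(** The systems solved by x and p are adjoint up to the source b, so the
    convolution of x and p would be constant in time if b were null.  Applied
    with three test families p: the transition matrices, the uniformized ones,
    and those of the time-reversed system. *)
Lemma backward_pairing (x b : nat -> R -> 'rV[R]_m) (p : nat -> R -> 'M[R]_m)
    (T : R) (n : nat) (i : 'I_m) : 0 <= T ->
  (forall n, solves_neg_deriv (x n) (fun u =>
      x n u *m C + prev (fun k => x k u) n *m D + b n u)) ->
  (forall n a, mu.-integrable `[0, T] (EFin \o (fun u => x n u 0 a))) ->
  (forall n a, mu.-integrable `[0, T] (EFin \o (fun u => b n u 0 a))) ->
  (forall n a j (t : R), is_derive t (1 : R) (fun t => p n t a j)
     ((C *m p n t + D *m prev (fun k => p k t) n) a j)) ->
  (\sum_(k < n.+1) x (n - k)%N 0 *m p k 0) 0 i -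
  (\sum_(k < n.+1) x (n - k)%N T *m p k T) 0 i =
  \int[mu]_(u in `[0, T]) (\sum_(k < n.+1) b (n - k)%N u *m p k u) 0 i.
Proof.
move=> T0 ode xi bi dp.
have mT : measurable (`[0, T]%classic : set (measurableTypeR R)) by exact: measurable_itv.
pose g k u := x k u *m C + prev (fun k => x k u) k *m D + b k u.
pose q k t := C *m p k t + D *m prev (fun k => p k t) k.
have cp k a j : continuous (fun t => p k t a j).
  move=> t; apply: differentiable_continuous; apply/derivable1_diffP.
  by have [] := dp k a j t.
have cprev k a j : continuous (fun t => prev (fun k => p k t) k a j).
  case: k => [|k] /=; last exact: cp.
  by move=> t; rewrite mxE; exact: cvg_cst.
have cq k a j : continuous (fun t => q k t a j).
  move=> t; rewrite /q.
  under eq_fun do rewrite mxE !mxE.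
  apply: cvgD.
    by apply: cvg_big => [|c _]; [exact: add_continuous|apply: cvgMr; exact: cp].
  by apply: cvg_big => [|c _]; [exact: add_continuous|apply: cvgMr; exact: cprev].
have previ k a : mu.-integrable `[0, T] (EFin \o (fun u => prev (fun k => x k u) k 0 a)).
  case: k => [|k] //=.
  by apply: eq_integrable (@integrable0 _ _ _ mu _) => // u _ /=; rewrite mxE.
have gi k a : mu.-integrable `[0, T] (EFin \o (fun u => g k u 0 a)).
  have := integrable_addr mT (integrable_addr mT
    (integrable_mulmx C a mT (xi k)) (integrable_mulmx D a mT (previ k)))
    (bi k a).
  by apply: eq_integrable => // u _ /=; congr EFin; rewrite /g !mxE.
have cbi f h : mu.-integrable `[0, T] (EFin \o f) -> continuous h ->
    mu.-integrable `[0, T] (EFin \o (fun u => f u * h u)).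
  move=> fi ch; have [K K0 hK] := continuous_bounded_itv T ch.
  apply: (integrable_mul_bounded (K := K) mT _ _ fi).
    by apply: measurable_funTS; exact: continuous_measurable_fun.
  by move=> t; rewrite /= in_itv/=; exact: hK.
transitivity (\sum_(k < n.+1) \sum_a \int[mu]_(u in `[0, T])
    (g (n - k)%N u 0 a * p k u a i - x (n - k)%N u 0 a * q k u a i)).
  rewrite !summxE -sumrB; apply: eq_bigr => k _.
  rewrite !mxE -sumrB; apply: eq_bigr => a _.
  by apply: integral_by_parts => //; exact: ode.
transitivity (\int[mu]_(u in `[0, T]) \sum_(k < n.+1) \sum_a
    (g (n - k)%N u 0 a * p k u a i - x (n - k)%N u 0 a * q k u a i)).
  have ti (k : 'I_n.+1) a : mu.-integrable `[0, T] (EFin \o (fun u =>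
      g (n - k)%N u 0 a * p k u a i - x (n - k)%N u 0 a * q k u a i)).
    by apply: integrable_subr => //; apply: cbi.
  rewrite Rintegral_sum//; last by move=> k; apply: integrable_sumr.
  by apply: eq_bigr => k _; rewrite Rintegral_sum.
apply: eq_Rintegral => u _.
rewrite -(convolution_cancel (fun k => x k u) (fun k => b k u) (fun k => p k u)).
rewrite summxE; apply: eq_bigr => k _.
by rewrite !mxE -sumrB.
Qed.

End Pairing.

(** * Transition probabilities lie between 0 and 1 *)

Section Reversal.
Variables (R : realType) (m : nat).
Local Notation mu := (@lebesgue_measure R).
Implicit Types (C D : 'M[R]_m).

Lemma is_derive_reflect (f : R -> R) (df T u : R) :
  is_derive (T - u) (1 : R) f df -> is_derive u (1 : R) (fun u => f (T - u)) (- df).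
Proof.
move=> dfT.
have dg : is_derive u (1 : R) (fun u => T - u) (-1).
  have := is_deriveB (is_derive_cst T u 1) (is_derive_id u 1).
  by rewrite sub0r.
have := @is_derive1_comp R f (fun u => T - u) u df (-1) dfT dg.
by rewrite mulrN1.
Qed.

Lemma is_derive_expR_scaled (c t : R) :
  is_derive t (1 : R) (fun t => expR (c * t)) (c * expR (c * t)).
Proof.
have dg : is_derive t (1 : R) (fun t => c * t) c.
  have := is_deriveZ c (is_derive_id t (1 : R)).
  by rewrite [c *: _]mulr1.
have := @is_derive1_comp R (@expR R) (fun t => c * t) t _ c (is_derive_expR _) dg.
by rewrite mulrC.
Qed.

(** Read backwards from time T, a row of the transition matrices solves the same
    system as the queue densities, by the forward equation. *)
Lemma count_mx_row_reversed C D (T : R) (i : 'I_m) n :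
  solves_neg_deriv (fun u => row i (count_mx C D n (T - u))) (fun u =>
    row i (count_mx C D n (T - u)) *m C +
    prev (fun k => row i (count_mx C D k (T - u))) n *m D + 0).
Proof.
move=> a u w u0 uw.
pose r u := ((row i (count_mx C D n (T - u)) *m C +
  prev (fun k => row i (count_mx C D k (T - u))) n *m D + 0) 0 a).
have dr t : is_derive t (1 : R) (fun t => - count_mx C D n (T - t) i a) (r t).
  have := is_deriveN (is_derive_reflect (is_derive_count_mx C D n i a (T - t))).
  rewrite opprK count_mx_comm.
  have -> // : r t = (count_mx C D n (T - t) *m C +
    prev (fun l => count_mx C D l (T - t)) n *m D) i a.
  rewrite /r addr0 -row_mul.
  have -> : prev (fun k => row i (count_mx C D k (T - t))) n =
            row i (prev (fun k => count_mx C D k (T - t)) n).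
    by rewrite /prev; case: (n) => [|k] //; rewrite raddf0.
  by rewrite -row_mul -raddfD mxE.
have cr : continuous r.
  have cc l b : continuous (fun t => row i (count_mx C D l (T - t)) 0 b).
    have -> : (fun t => row i (count_mx C D l (T - t)) 0 b) =
              (fun t => count_mx C D l (T - t) i b) by apply/funext => t; rewrite mxE.
    move=> t; apply: differentiable_continuous; apply/derivable1_diffP.
    by have [] := is_derive_reflect (is_derive_count_mx C D l i b (T - t)).
  have cp l b : continuous (fun t => prev (fun k => row i (count_mx C D k (T - t))) l 0 b).
    case: l => [|l] /=; last exact: cc.
    by move=> t; rewrite mxE; exact: cvg_cst.
  move=> t; rewrite /r; under eq_fun do rewrite addr0 mxE !mxE.
  apply: cvgD.
    apply: cvg_big => [|c _]; first exact: add_continuous.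
    by apply: cvgMl; exact: cc.
  by apply: cvg_big => [|c _]; [exact: add_continuous|apply: cvgMl; exact: cp].
rewrite -(FTC_is_derive uw dr cr) !mxE.
by rewrite opprK addrC.
Qed.

End Reversal.

Section Uniformization.
Variables (R : realType) (m : nat) (C D : 'M[R]_m).
Hypothesis mapCD : is_map C D.
Local Notation mu := (@lebesgue_measure R).

(* a rate dominating all the diagonal rates of C *)
Let theta : R := \sum_i `|C i i|.
Let B := C + theta%:M.

Let theta0 : 0 <= theta. Proof. exact: sumr_ge0. Qed.

Let B_ge0 i j : 0 <= B i j.
Proof.
rewrite !mxE; have [->|ij] := eqVneq i j.
  rewrite mulr1n /theta (bigD1 j)//= addrA.
  rewrite addr_ge0 ?sumr_ge0//; have := ler_norm (- C j j); rewrite normrN; lra.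
by rewrite mulr0n addr0; exact: (map_offdiag mapCD).
Qed.

Let BD_row i : \sum_a (`|B i a| + `|D i a|) <= theta.
Proof.
have := map_gen mapCD; move/matrixP/(_ i 0); rewrite !mxE.
under eq_bigr do rewrite !mxE mulr1.
move=> CD0.
under eq_bigr do rewrite (ger0_norm (B_ge0 _ _)) (ger0_norm (map_arr mapCD _ _)).
have -> : \sum_a (B i a + D i a) = \sum_a (C i a + D i a) + \sum_a (theta%:M : 'M[R]_m) i a.
  by rewrite -big_split; apply: eq_bigr => a _; rewrite /= /B mxE addrAC.
rewrite CD0 add0r (bigD1 i)//= big1 ?addr0 => [|a ai]; rewrite !mxE ?eqxx//.
by rewrite eq_sym (negbTE ai).
Qed.

(** Both sides solve the same linear system with the same initial value; pairing
    one of them, reversed in time, with the other compares them at time T. *)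
Lemma uniformization n (T : R) : 0 <= T ->
  count_mx C D n T = expR (- theta * T) *: count_mx B D n T.
Proof.
move=> T0; apply/matrixP => i j.
pose x n u := row i (count_mx C D n (T - u)).
pose p n t := expR (- theta * t) *: count_mx B D n t.
have cx k a : continuous (fun u => x k u 0 a).
  have -> : (fun u => x k u 0 a) = (fun u => count_mx C D k (T - u) i a).
    by apply/funext => u; rewrite mxE.
  move=> t; apply: differentiable_continuous; apply/derivable1_diffP.
  by have [] := is_derive_reflect (is_derive_count_mx C D k i a (T - t)).
have dp k a b t : is_derive t (1 : R) (fun t => p k t a b)
    ((C *m p k t + D *m prev (fun k => p k t) k) a b).
  have -> : (fun t => p k t a b) =
      (fun t => expR (- theta * t)) * (fun t => count_mx B D k t a b).
    by apply/funext => u; rewrite /p mxE.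
  apply: is_derive_eq (is_deriveM (is_derive_expR_scaled (- theta) t)
    (is_derive_count_mx B D k a b t)) _.
  set c := count_mx B D k t; set c' := prev _ k.
  have -> : prev (fun k => p k t) k = expR (- theta * t) *: c'.
    by rewrite /c' /prev; case: (k) => [|l] //; rewrite scaler0.
  have -> : C *m p k t = expR (- theta * t) *: (B *m c) - (theta * expR (- theta * t)) *: c.
    rewrite /B mulmxDl mul_scalar_mx scalerDr scalerA -scalemxAr.
    by rewrite [expR _ * _]mulrC addrK.
  rewrite -scalemxAr /GRing.scale/=.
  set X := B *m c; set Y := D *m c'; rewrite !mxE; ring.
have ix k a : mu.-integrable `[0, T] (EFin \o (fun u => x k u 0 a)).
  apply: continuous_compact_integrable; first exact: segment_compact.
  by apply: continuous_subspaceT; exact: cx.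
have i0 (k : nat) a : mu.-integrable `[0, T] (EFin \o (fun u : R => (0 : 'rV[R]_m) 0 a)).
  by apply: eq_integrable (@integrable0 _ _ _ mu _) => // u _ /=; rewrite mxE.
have := backward_pairing n j T0 (count_mx_row_reversed C D T i) ix i0 dp.
have -> : \sum_(k < n.+1) x (n - k)%N 0 *m p k 0 = row i (count_mx C D n T).
  rewrite big_ord_recl big1 => [|k _].
    by rewrite /p count_mx0 mulr0 expR0 scale1r mulmx1 addr0 subn0 /x subr0.
  by rewrite /p count_mx0/= scaler0 mulmx0.
have -> : \sum_(k < n.+1) x (n - k)%N T *m p k T = row i (p n T).
  rewrite big_ord_recr big1 => [|k _].
    by rewrite /= /x subrr subnn count_mx0 add0r row1 -rowE.
  rewrite /x subrr count_mx0; have -> : (n - k = (n - k).-1.+1)%N.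
    by rewrite prednK// subn_gt0 /=.
  by rewrite /= raddf0 mul0mx.
have -> : \int[mu]_(u in `[0, T]) (\sum_(k < n.+1) (0 : 'rV[R]_m) *m p k u) 0 j = 0.
  have e0 u : (\sum_(k < n.+1) (0 : 'rV[R]_m) *m p k u) 0 j = 0.
    by rewrite big1 ?mxE// => k _; rewrite mul0mx.
  under eq_Rintegral do rewrite e0.
  by rewrite Rintegral_cst_itv// mul0r.
by move/eqP; rewrite !mxE subr_eq0 => /eqP.
Qed.

Lemma count_mx_ge0 n (t : R) i j : 0 <= t -> 0 <= count_mx C D n t i j.
Proof.
move=> t0; rewrite uniformization// mxE mulr_ge0 ?expR_ge0// count_mxE.
apply: egf_ge0 => //; first exact: jump_mx_growth.
by move=> k; apply: jump_mx_ge0; [exact: B_ge0|exact: (map_arr mapCD)].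
Qed.

(** The rows of C + theta I + D sum to theta, so the power series of the
    uniformized matrices is dominated by that of exp(theta t). *)
Lemma count_mx_le1 n (t : R) i j : 0 <= t -> count_mx C D n t i j <= 1.
Proof.
move=> t0; rewrite uniformization// mxE count_mxE.
have bound : `|egf (fun k => jump_mx B D k n i j) t| <= expR (theta * t).
  have := @egf_le R (fun k => jump_mx B D k n i j) 1 theta t.
  rewrite mul1r (ger0_norm t0); apply => // k.
  by rewrite mul1r; exact: jump_mx_le.
rewrite mulNr expRN ler_pdivrMl ?expR_gt0// mulr1.
exact: le_trans (ler_norm _) bound.
Qed.

End Uniformization.

(** * Linear systems on the half-line *)

Section Transform.
Variables (R : realType) (m : nat) (C D : 'M[R]_m).
Local Notation mu := (@lebesgue_measure R).
Local Notation Rp := (`[0, +oo[%classic : set R).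

(** Uniqueness for the system without source.  The test family solves the adjoint
    system and equals the identity at time T, being built from the transition
    series of (-C, -D) in the variable T - t; the pairing then reads off x_n(T). *)
Lemma ode_zero (x : nat -> R -> 'rV[R]_m) :
  (forall n, solves_neg_deriv (x n) (fun u =>
      x n u *m C + prev (fun k => x k u) n *m D + 0)) ->
  (forall n a, mu.-integrable Rp (EFin \o (fun u => x n u 0 a))) ->
  (forall n, x n 0 = 0) ->
  forall n T, 0 <= T -> x n T = 0.
Proof.
move=> ode xi x0 n T T0; apply/rowP => i.
pose p n t := count_mx (- C) (- D) n (T - t).
have dp k a b t : is_derive t (1 : R) (fun t => p k t a b)
    ((C *m p k t + D *m prev (fun k => p k t) k) a b).
  apply: is_derive_eq (is_derive_reflect (is_derive_count_mx _ _ _ _ _ _)) _.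
  by rewrite !mulNmx -opprD mxE opprK.
have ix k a : mu.-integrable `[0, T] (EFin \o (fun u => x k u 0 a)).
  exact: integrable_itv0.
have i0 (k : nat) a : mu.-integrable `[0, T] (EFin \o (fun u : R => (0 : 'rV[R]_m) 0 a)).
  by apply: eq_integrable (@integrable0 _ _ _ mu _) => // u _ /=; rewrite mxE.
have := backward_pairing n i T0 ode ix i0 dp.
have -> : \int[mu]_(u in `[0, T]) (\sum_(k < n.+1) (0 : 'rV[R]_m) *m p k u) 0 i = 0.
  have e0 u : (\sum_(k < n.+1) (0 : 'rV[R]_m) *m p k u) 0 i = 0.
    by rewrite big1 ?mxE// => k _; rewrite mul0mx.
  under eq_Rintegral do rewrite e0.
  by rewrite Rintegral_cst_itv// mul0r.
have -> : \sum_(k < n.+1) x (n - k)%N 0 *m p k 0 = 0.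
  by rewrite big1 // => k _; rewrite x0 mul0mx.
rewrite big_ord_recl big1 => [|k _].
  by rewrite /p subrr count_mx0 mulmx1 addr0 subn0 !mxE sub0r => /eqP; rewrite oppr_eq0 => /eqP.
by rewrite /p subrr count_mx0/= mulmx0.
Qed.

Hypothesis mapCD : is_map C D.

(** The boundary term at T is dominated by a sum of entries of the x_k(T), which is
    small along some sequence of times T tending to infinity. *)
Lemma service_transform (x : nat -> R -> 'rV[R]_m) (F : 'rV[R]_m) (f : R -> R) :
  (forall n, solves_neg_deriv (x n) (fun u =>
      x n u *m C + prev (fun k => x k u) n *m D +
      f u *: initial F n)) ->
  (forall n a, mu.-integrable Rp (EFin \o (fun u => x n u 0 a))) ->
  (forall n a u, 0 <= u -> 0 <= x n u 0 a) ->
  mu.-integrable Rp (EFin \o f) ->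
  forall n, x n 0 = F *m arrivals_mx C D f n.
Proof.
move=> ode xi x0 fi n; apply/rowP => i.
have mRp : measurable (Rp : set (measurableTypeR R)) by exact: measurable_itv.
pose P := count_mx C D.
have fPi a : mu.-integrable Rp (EFin \o (fun u => f u * P n u a i)).
  apply: (integrable_mul_bounded (K := 1) mRp _ _ fi).
    apply: measurable_funTS; apply: continuous_measurable_fun.
    exact: count_mx_continuous.
  move=> u; rewrite /= in_itv/= andbT => u0.
  by rewrite ger0_norm ?count_mx_ge0// count_mx_le1.
pose k u := \sum_a F 0 a * (f u * P n u a i).
have ki : mu.-integrable Rp (EFin \o k).
  by apply: integrable_sumr => // a; apply: integrable_scaler.
have -> : (F *m arrivals_mx C D f n) 0 i = \int[mu]_(u in Rp) k u.
  rewrite mxE Rintegral_sum// => [|a]; last exact: integrable_scaler.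
  apply: eq_bigr => a _; rewrite RintegralZl// mxE; congr (_ * _).
  by apply: eq_Rintegral => u _; exact: mulrC.
pose rest T := (\sum_(j < n.+1) x (n - j)%N T *m P j T) 0 i.
pose y u := \sum_(j < n.+1) \sum_a x (n - j)%N u 0 a.
have rest_le T : 0 <= T -> 0 <= rest T <= y T.
  move=> T0; rewrite /rest summxE; apply/andP; split.
    apply: sumr_ge0 => j _; rewrite mxE; apply: sumr_ge0 => a _.
    by apply: mulr_ge0; [exact: x0|exact: count_mx_ge0].
  apply: ler_sum => j _; rewrite mxE; apply: ler_sum => a _.
  by apply: ler_piMr; [exact: x0|exact: count_mx_le1].
have partial T : 0 <= T -> \int[mu]_(u in `[0, T]) k u = x n 0 0 i - rest T.
  move=> T0.
  have mT : measurable (`[0, T]%classic : set (measurableTypeR R)) by exact: measurable_itv.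
  have bi j a : mu.-integrable `[0, T] (EFin \o (fun u => (f u *: initial F j) 0 a)).
    have := integrable_scaler (initial F j 0 a) mT (integrable_itv0 T fi).
    by apply: eq_integrable => // u _ /=; rewrite mxE mulrC.
  have := backward_pairing n i T0 ode (fun j a => integrable_itv0 T (xi j a)) bi
     (fun j a b t => is_derive_count_mx C D j a b t).
  rewrite -/(rest T).
  have -> : \sum_(j < n.+1) x (n - j)%N 0 *m count_mx C D j 0 = x n 0.
    rewrite big_ord_recl big1 => [|j _].
      by rewrite count_mx0 mulmx1 addr0 subn0.
    by rewrite count_mx0/= mulmx0.
  move=> ->; apply: eq_Rintegral => u _.
  rewrite big_ord_recr big1 => [|j _].
    rewrite /= subnn add0r -scalemxAl !mxE /k mulr_sumr; apply: eq_bigr => a _.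
    by rewrite mulrCA.
  have -> : (n - j = (n - j).-1.+1)%N by rewrite prednK// subn_gt0 /=.
  by rewrite /= scaler0 mul0mx.
have yi : mu.-integrable Rp (EFin \o y).
  by do 2 (apply: integrable_sumr => // ?).
have y0 t : 0 <= t -> 0 <= y t.
  by move=> t0; do 2 (apply: sumr_ge0 => ? _); exact: x0.
have small (N : nat) : exists T, N%:R <= T /\ y T < N.+1%:R^-1.
  have [||T] := @integrable_takes_small_values _ y N.+1%:R^-1 N%:R _ _ y0 yi => //.
  by exists T.
have [T TP] := choice small.
have TN N : N%:R <= T N by have [] := TP N.
have lim1 := Rintegral_cvg_half_line TN ki.
have lim2 : (\int[mu]_(u in `[0, T N]) k u) @[N --> \oo] --> x n 0 0 i.
  have -> : (fun N => \int[mu]_(u in `[0, T N]) k u) = (fun N => x n 0 0 i - rest (T N)).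
    by apply/funext => N; rewrite partial// (le_trans _ (TN N)).
  rewrite -[X in _ --> X]subr0; apply: cvgB; first exact: cvg_cst.
  apply: (squeeze_cvgr _ (cvg_cst 0) (@cvg_harmonic R)).
  near=> N; have [NT yT] := TP N.
  have /andP[-> rT] := rest_le (T N) (le_trans (ler0n _ _) NT).
  by rewrite (le_trans rT)// ltW.
exact: cvg_unique lim2 lim1.
Unshelve. all: end_near. Qed.

End Transform.

(** * The stationary densities *)

Section SteadyState.
Variables (R : realType) (m h H : nat) (eps : bool).
Variables (C D : 'M[R]_m) (s v : nat -> R -> R).
Variables (idle : nat -> 'rV[R]_m) (xi gam : nat -> nat -> R -> 'rV[R]_m).
Hypothesis hH : (1 <= h < H)%N.
Hypothesis mapCD : is_map C D.
Hypothesis s_dens : forall r, (h <= r <= H)%N -> is_time_density (s r).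
Hypothesis v_dens : forall k, (k < h)%N -> is_time_density (v k).
Hypothesis SS : is_steady_state h H eps C D s v idle xi gam.
Local Notation mu := (@lebesgue_measure R).
Local Notation Rp := (`[0, +oo[%classic : set R).
Local Notation start := (start_flow h H xi gam).

Let mRp : measurable (Rp : set (measurableTypeR R)).
Proof. exact: measurable_itv. Qed.

Lemma time_density_integrable (f : R -> R) : is_time_density f ->
  mu.-integrable Rp (EFin \o f).
Proof.
move=> [mf f0 f1 _]; apply/integrableP; split.
  by apply/measurable_EFinP; exact: mf.
rewrite (_ : (\int[mu]_(x in Rp) `|(EFin \o f) x|)%E = (\int[mu]_(x in Rp) (f x)%:E)%E).
  by rewrite f1 ltry.
apply: eq_integral => x; rewrite inE/= in_itv/= andbT => x0.
by rewrite ger0_norm// f0.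
Qed.

Let pdens_e_ge0 (f : R -> 'rV[R]_m) (u : R) : is_partial_density f -> 0 <= u ->
  0 <= (f u *m (const_mx 1 : 'cV[R]_m)) 0 0.
Proof.
move=> df u0; rewrite mxE; apply: sumr_ge0 => a _; rewrite mxE mulr1.
exact: pdens_ge0 df a u u0.
Qed.

Lemma active_mass_le1 : (active_mass h H xi gam Rp <= 1)%E.
Proof.
rewrite -(ss_total SS); apply: leeDr; rewrite lee_fin.
apply: mulr_ge0; first by case: eps; rewrite ?subrr ?subr0.
rewrite big_mkord; apply: sumr_ge0 => n _; rewrite mxE; apply: sumr_ge0 => a _.
by rewrite mxE mulr1; apply: (ss_idle_ge0 SS).
Qed.

Let vac_index n k : (k \in index_iota 0 (minn n h.-1).+1) = (k < h)%N && (k <= n)%N.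
Proof. by rewrite mem_index_iota/=; lia. Qed.

Let xi_mass n r := (\int[mu]_(u in Rp) ((xi n r u *m (const_mx 1 : 'cV[R]_m)) 0 0)%:E)%E.
Let gam_mass n k := (\int[mu]_(u in Rp) ((gam n k u *m (const_mx 1 : 'cV[R]_m)) 0 0)%:E)%E.

Let xi_mass_ge0 n r : (h <= r <= H)%N -> (0 <= xi_mass n r)%E.
Proof.
move=> hr; apply: integral_ge0 => u; rewrite /= in_itv/= andbT => u0.
by rewrite lee_fin; apply: pdens_e_ge0 => //; exact: (ss_xi_dens SS).
Qed.

Let gam_mass_ge0 n k : (k < h)%N -> (k <= n)%N -> (0 <= gam_mass n k)%E.
Proof.
move=> kh kn; apply: integral_ge0 => u; rewrite /= in_itv/= andbT => u0.
by rewrite lee_fin; apply: pdens_e_ge0 => //; exact: (ss_gam_dens SS).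
Qed.

(** The total mass bounds each of its terms, which makes every density
    integrable. *)
Lemma level_mass_le1 n : (\sum_(h <= r < H.+1) xi_mass n r
  + \sum_(0 <= k < (minn n h.-1).+1) gam_mass n k <= 1)%E.
Proof.
apply: le_trans active_mass_le1.
pose u_ n := (\sum_(h <= r < H.+1) xi_mass n r
  + \sum_(0 <= k < (minn n h.-1).+1) gam_mass n k)%E.
have -> : active_mass h H xi gam Rp = (\sum_(0 <= n <oo) u_ n)%E by [].
rewrite -/(u_ n).
have u0 k : (0 <= u_ k)%E.
  rewrite /u_; apply: adde_ge0; rewrite big_seq; apply: sume_ge0 => r.
    by rewrite mem_index_iota => hr; apply: xi_mass_ge0; lia.
  by rewrite vac_index => /andP[kh kn]; exact: gam_mass_ge0.
apply: le_trans (nneseries_lim_ge n.+1 (fun k _ _ => u0 k)).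
rewrite big_nat_recr//=; apply: leeDr.
by apply: sume_ge0 => k _; exact: u0.
Qed.

Let pdens_integrable (f : R -> 'rV[R]_m) : is_partial_density f ->
  (\int[mu]_(u in Rp) ((f u *m (const_mx 1 : 'cV[R]_m)) 0 0)%:E <= 1)%E ->
  forall i, mu.-integrable Rp (EFin \o (fun u => f u 0 i)).
Proof.
move=> df f1 i; apply/integrableP; split.
  by apply/measurable_EFinP; exact: (pdens_meas df).
apply: (@le_lt_trans _ _ 1%E); last by rewrite ltry.
apply: le_trans f1; apply: ge0_le_integral => //.
- by apply: measurableT_comp => //; apply/measurable_EFinP; exact: (pdens_meas df).
- apply/measurable_EFinP.
  have -> : (fun u => (f u *m (const_mx 1 : 'cV[R]_m)) 0 0) = (fun u => \sum_a f u 0 a).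
    by apply/funext => u; rewrite mxE; apply: eq_bigr => a _; rewrite mxE mulr1.
  by apply: measurable_sum => a; exact: (pdens_meas df).
- move=> u; rewrite /= in_itv/= andbT => u0.
  rewrite lee_fin ger0_norm ?(pdens_ge0 df)// mxE (bigD1 i)//= mxE mulr1 lerDl.
  by apply: sumr_ge0 => a _; rewrite mxE mulr1; exact: (pdens_ge0 df).
Qed.

Lemma xi_integrable n r i : (h <= r <= H)%N ->
  mu.-integrable Rp (EFin \o (fun u => xi n r u 0 i)).
Proof.
move=> hr; apply: pdens_integrable; first exact: (ss_xi_dens SS).
apply: le_trans (level_mass_le1 n).
have rin : r \in index_iota h H.+1 by rewrite mem_index_iota; lia.
rewrite (bigD1_seq r rin (iota_uniq _ _))/=.
rewrite -addeA; apply: leeDl; apply: adde_ge0.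
  rewrite big_seq_cond; apply: sume_ge0 => q.
  by rewrite mem_index_iota => /andP[hq _]; apply: xi_mass_ge0; lia.
rewrite big_seq; apply: sume_ge0 => k.
by rewrite vac_index => /andP[kh kn]; exact: gam_mass_ge0.
Qed.

Lemma gam_integrable n k i : (k < h)%N -> (k <= n)%N ->
  mu.-integrable Rp (EFin \o (fun u => gam n k u 0 i)).
Proof.
move=> kh kn; apply: pdens_integrable; first exact: (ss_gam_dens SS).
apply: le_trans (level_mass_le1 n).
apply: (@le_trans _ _ (\sum_(0 <= k < (minn n h.-1).+1) gam_mass n k)%E); last first.
  apply: leeDr; rewrite big_seq; apply: sume_ge0 => q.
  by rewrite mem_index_iota => hq; apply: xi_mass_ge0; lia.
have kin : k \in index_iota 0 (minn n h.-1).+1 by rewrite vac_index kh.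
rewrite (bigD1_seq k kin (iota_uniq _ _))/=.
apply: leeDl; rewrite big_seq_cond; apply: sume_ge0 => q.
by rewrite vac_index => /andP[/andP[qh qn] _]; exact: gam_mass_ge0.
Qed.

(** The batch H is the only one whose service may start with customers left in
    the queue, hence a source at each level. *)
Definition xi_source r n : 'rV[R]_m :=
  if r == H then start (n + H)%N else
  initial (start r + (if r == h then (1 - eps%:R) *: (idle h.-1 *m D) else 0)) n.

Definition gam_source k n : 'rV[R]_m :=
  initial (\sum_(h <= r < H.+1) xi k r 0 +
           eps%:R *: \sum_(0 <= j < k.+1) gam k j 0) n.

Lemma xi_ode r : (h <= r <= H)%N -> forall n,
  solves_neg_deriv (xi n r) (fun u =>
    xi n r u *m C + prev (fun k => xi k r u) n *m D + s r u *: xi_source r n).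
Proof.
move=> hr; rewrite /xi_source; case: (eqVneq r H) => [-> | rH] [|n] /=.
- have := ss_xi0 SS (r := H); rewrite add0n => /(_ _)/=.
  have -> : (h < H <= H)%N by lia.
  move=> /(_ isT); congr solves_neg_deriv; apply/funext => u.
  by rewrite mul0mx addr0.
- exact: (ss_xiH SS (n := n.+1)).
- case: (eqVneq r h) => [-> | rh].
    have := ss_xi0h SS; congr solves_neg_deriv; apply/funext => u.
    rewrite mul0mx addr0 [in RHS]scalerDr scalerA -addrA; congr (_ + _).
    by rewrite addrC [s h u * _]mulrC.
  have := ss_xi0 SS (r := r); have -> : (h < r <= H)%N by lia.
  move=> /(_ isT); congr solves_neg_deriv; apply/funext => u.
  by rewrite mul0mx !addr0.
- have := ss_xi SS (n := n.+1) (r := r); have -> : (h <= r <= H.-1)%N by lia.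
  move=> /(_ isT isT); congr solves_neg_deriv; apply/funext => u.
  by rewrite scaler0 addr0.
Qed.

(** The levels are counted from k, the queue length at the start of the vacation. *)
Lemma gam_ode k : (k < h)%N -> forall n,
  solves_neg_deriv (gam (k + n)%N k) (fun u =>
    gam (k + n)%N k u *m C + prev (fun j => gam (k + j)%N k u) n *m D +
    v k u *: gam_source k n).
Proof.
move=> kh [|n] /=.
  have := ss_gam0 SS kh; rewrite addn0; congr solves_neg_deriv.
  by apply/funext => u; rewrite mul0mx addr0.
rewrite addnS; have := ss_gam SS (n := (k + n).+1) kh; rewrite ltnS leq_addr => /(_ isT).
by congr solves_neg_deriv; apply/funext => u; rewrite scaler0 addr0.
Qed.

Lemma xi_transform r n : (h <= r < H)%N ->
  xi n r 0 = (start r + (if r == h then (1 - eps%:R) *: (idle h.-1 *m D) else 0))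
    *m arrivals_mx C D (s r) n.
Proof.
move=> hr; have hrH : (h <= r <= H)%N by lia.
apply: (service_transform mapCD (x := fun n => xi n r)).
- move=> k; have := xi_ode hrH k; rewrite /xi_source.
  by have -> : (r == H) = false by lia.
- by move=> k a; exact: xi_integrable.
- by move=> k a u u0; apply: (pdens_ge0 (ss_xi_dens SS k hrH)).
- exact/time_density_integrable/s_dens.
Qed.

Lemma ode_average (x b : nat -> R -> 'rV[R]_m) n i :
  (forall n, solves_neg_deriv (x n) (fun u =>
      x n u *m C + prev (fun k => x k u) n *m D + b n u)) ->
  (forall n a, mu.-integrable Rp (EFin \o (fun u => x n u 0 a))) ->
  (forall n a, mu.-integrable Rp (EFin \o (fun u => b n u 0 a))) ->
  (\int[mu]_(u in `[0, d]) x n u 0 i) / d @[d --> 0^'+] --> x n 0 0 i.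
Proof.
move=> ode xI bI.
apply: average_cvg_at0; first exact: (ode n i).
have pI a : mu.-integrable Rp (EFin \o (fun u => prev (fun k => x k u) n 0 a)).
  case: (n) => [|k] //=.
  by apply: eq_integrable (@integrable0 _ _ _ mu _) => // u _ /=; rewrite mxE.
have := integrable_addr mRp (integrable_addr mRp (integrable_mulmx C i mRp (xI n))
  (integrable_mulmx D i mRp pI)) (bI n i).
by apply: eq_integrable => // u _ /=; congr EFin; rewrite !mxE.
Qed.

Let source_integrable (f : R -> R) (F : 'rV[R]_m) a :
  mu.-integrable Rp (EFin \o f) -> mu.-integrable Rp (EFin \o (fun u => (f u *: F) 0 a)).
Proof.
move=> fi; have := integrable_scaler (F 0 a) mRp fi.
by apply: eq_integrable => // u _ /=; rewrite mxE mulrC.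
Qed.

Lemma xi_average n r i : (h <= r <= H)%N ->
  (\int[mu]_(u in `[0, d]) xi n r u 0 i) / d @[d --> 0^'+] --> xi n r 0 0 i.
Proof.
move=> hr; apply: (@ode_average (fun n => xi n r)
  (fun n u => s r u *: xi_source r n) n i (xi_ode hr)).
  by move=> k a; exact: xi_integrable.
by move=> k a; apply/source_integrable/time_density_integrable/s_dens.
Qed.

Lemma gam_average n k i : (k < h)%N -> (k <= n)%N ->
  (\int[mu]_(u in `[0, d]) gam n k u 0 i) / d @[d --> 0^'+] --> gam n k 0 0 i.
Proof.
move=> kh kn; rewrite -(subnKC kn).
apply: (@ode_average (fun n => gam (k + n)%N k)
  (fun n u => v k u *: gam_source k n) (n - k)%N i (gam_ode kh)).
  by move=> j a; apply: gam_integrable; rewrite ?leq_addr.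
by move=> j a; apply/source_integrable/time_density_integrable/v_dens.
Qed.

(** Each balance equation gives the dormant vector with n customers as the inflow
    from vacations plus the flow from n - 1 customers, times (-C)^-1. *)
Lemma idle_closed_form n : ~~ eps -> (n < h)%N ->
  idle n = \sum_(0 <= j < n.+1) (\sum_(0 <= k < j.+1) gam j k 0)
     *m (Dtilde C D ^+ (n - j)) *m invmx (- C).
Proof.
move=> epsF nh.
have e1 : 1 - eps%:R = 1 :> R by rewrite (negbTE epsF) subr0.
have uC : - C \in unitmx by rewrite -scaleN1r unitmxZ ?unitrN1// (map_inv mapCD).
have solve (a w : 'rV[R]_m) : 0 = a *m C + w -> a = w *m invmx (- C).
  move=> /eqP; rewrite eq_sym addrC addr_eq0 => /eqP ->.
  by rewrite -mulmxN mulmxK.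
elim: n nh => [|n IH] nh.
  rewrite big_nat1 subnn expr0 mulmx1 big_nat1; apply: solve.
  by have := ss_idle0 SS; rewrite e1 scale1r.
have := ss_idle SS (n := n.+1); rewrite nh => /(_ isT); rewrite e1 scale1r -addrA => /solve ->.
rewrite [in RHS]big_nat_recr//= subnn expr0 mulmx1 mulmxDl IH ?(ltnW nh)//; congr (_ + _).
rewrite !mulmx_suml; apply: eq_big_nat => j /andP[_ jn].
have -> : (n.+1 - j = (n - j).+1)%N by lia.
by rewrite exprSr /Dtilde !mulmxA.
Qed.

(** Without completion there is neither a source for any service or vacation nor
    an inflow into the dormant states, so that the total mass would vanish. *)
Lemma some_completion_flow_neq0 :
  (exists n r i, [/\ (h <= r <= H)%N & xi n r 0 0 i != 0]) \/
  (exists n k i, [/\ (k < h)%N, (k <= n)%N & gam n k 0 0 i != 0]).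
Proof.
apply: contrapT => /not_orP[noxi nogam].
have xi0 n r : (h <= r <= H)%N -> xi n r 0 = 0.
  move=> hr; apply/rowP => i; rewrite mxE; apply/eqP/negP => /negP nz.
  by apply: noxi; exists n, r, i.
have gam0 n k : (k < h)%N -> gam n k 0 = 0.
  move=> kh; have [kn|nk] := leqP k n; last exact: (ss_gam_conv SS).
  apply/rowP => i; rewrite mxE; apply/eqP/negP => /negP nz.
  by apply: nogam; exists n, k, i.
have start0 l : start l = 0.
  rewrite /start_flow !big_nat !big1 ?addr0// => j; first by move=> ?; apply: xi0; lia.
  by move=> jh; apply: gam0; lia.
have idle0 n : (n < h)%N -> (1 - eps%:R) *: idle n = 0.
  move=> nh; case epsE: eps; first by rewrite subrr scale0r.
  rewrite subr0 scale1r idle_closed_form ?epsE//.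
  rewrite big_nat big1// => j jn; rewrite big_nat big1 ?mul0mx// => k kj.
  by apply: gam0; lia.
have xi_zero n r u : (h <= r <= H)%N -> 0 <= u -> xi n r u = 0.
  move=> hr u0; apply: (ode_zero (C := C) (D := D) (x := fun n => xi n r)) => //.
  - move=> k; have := xi_ode hr k; rewrite /xi_source !start0.
    have -> : (if r == h then (1 - eps%:R) *: (idle h.-1 *m D) else 0) = 0 :> 'rV[R]_m.
      by case: ifP => // _; rewrite scalemxAl idle0 ?mul0mx//; lia.
    rewrite addr0; have -> : (if r == H then 0 else initial 0 k) = 0 :> 'rV[R]_m.
      by case: ifP => // _; case: (k).
    by congr solves_neg_deriv; apply/funext => w; rewrite scaler0.
  - by move=> k a; exact: xi_integrable.
  - by move=> k; exact: xi0.
have gam_zero n k u : (k < h)%N -> (k <= n)%N -> 0 <= u -> gam n k u = 0.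
  move=> kh kn u0; rewrite -(subnKC kn).
  apply: (ode_zero (C := C) (D := D) (x := fun n => gam (k + n)%N k)) => //.
  - move=> j; have := gam_ode kh j; rewrite /gam_source.
    have -> : \sum_(h <= r < H.+1) xi k r 0 = 0.
      by rewrite big_nat big1// => r hr; apply: xi0; lia.
    have -> : \sum_(0 <= j < k.+1) gam k j 0 = 0.
      by rewrite big_nat big1// => q qk; apply: gam0; lia.
    rewrite scaler0 addr0; have -> : initial 0 j = 0 :> 'rV[R]_m by case: (j).
    by congr solves_neg_deriv; apply/funext => w; rewrite scaler0.
  - by move=> j a; apply: gam_integrable; rewrite ?leq_addr.
  - by move=> j; exact: gam0.
have := ss_total SS.
have -> : active_mass h H xi gam Rp = 0%E.
  apply: eseries0 => n _ _; rewrite !big_nat !big1 ?adde0// => j jh.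
    apply: integral0_eq => u; rewrite /= in_itv/= andbT => u0.
    by rewrite gam_zero ?mul0mx ?mxE//; lia.
  apply: integral0_eq => u; rewrite /= in_itv/= andbT => u0.
  by rewrite xi_zero ?mul0mx ?mxE//; lia.
rewrite big_mkord mulr_sumr big1 => [|n _].
  by rewrite adde0 => /eqP; rewrite eqe eq_sym oner_eq0.
have /(congr1 (fun w => (w *m (const_mx 1 : 'cV[R]_m)) 0 0)) := idle0 n (ltn_ord n).
by rewrite mul0mx -scalemxAl !mxE.
Qed.

End SteadyState.

(** * Completion epochs *)

(** The limit of d / A d is read off from F, and it then determines that of
    G d / A d. *)
Lemma cvg_ratio_unique (R : realType) (F G A : R -> R) (f g p q : R) : f != 0 ->
  F d / d @[d --> 0^'+] --> f -> G d / d @[d --> 0^'+] --> g ->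
  F d / A d @[d --> 0^'+] --> p -> G d / A d @[d --> 0^'+] --> q ->
  q = p / f * g.
Proof.
move=> f0 Ff Gg Fp Gq.
have lim : (F d / A d) * (F d / d)^-1 * (G d / d) @[d --> 0^'+] --> p / f * g.
  by apply: cvgM Gg; apply: cvgM Fp _; exact: cvgV.
suff GA : G d / A d @[d --> 0^'+] --> p / f * g by exact: cvg_unique Gq GA.
apply: cvg_trans lim; apply: near_eq_cvg; near=> d.
have d0 : d != 0 by rewrite gt_eqF.
have Fd : F d / d != 0 by near: d; exact: (cvgr_neq0 _ Ff f0).
have {}Fd : F d != 0 by apply: contraNneq Fd => ->; rewrite mul0r.
have [->|Ad] := eqVneq (A d) 0; first by rewrite invr0 !mulr0 !mul0r.
by field; rewrite Ad d0 Fd.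
Unshelve. all: end_near. Qed.

Section CompletionLaw.
Variables (R : realType) (m h H : nat) (eps : bool).
Variables (C D : 'M[R]_m) (s v : nat -> R -> R).
Variables (idle : nat -> 'rV[R]_m) (xi gam : nat -> nat -> R -> 'rV[R]_m).
Variables xip gamp : nat -> nat -> 'rV[R]_m.
Hypothesis hH : (1 <= h < H)%N.
Hypothesis mapCD : is_map C D.
Hypothesis s_dens : forall r, (h <= r <= H)%N -> is_time_density (s r).
Hypothesis v_dens : forall k, (k < h)%N -> is_time_density (v k).
Hypothesis SS : is_steady_state h H eps C D s v idle xi gam.
Hypothesis CL : is_completion_law h H xi gam xip gamp.

(** The constant is the inverse of the total rate of completions; only its being
    common to all services and vacations matters, because the formula is linear
    in these vectors. *)
Lemma completion_proportional : exists c : R,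
  (forall n r, (h <= r <= H)%N -> xip n r = c *: xi n r 0) /\
  (forall n k, (k < h)%N -> (k <= n)%N -> gamp n k = c *: gam n k 0).
Proof.
pose mass d := fine (active_mass h H xi gam `[0, d]).
pose Xi n r i d := \int[lebesgue_measure]_(u in `[0, d]) xi n r u 0 i.
pose Gam n k i d := \int[lebesgue_measure]_(u in `[0, d]) gam n k u 0 i.
have XiA n r i : (h <= r <= H)%N -> Xi n r i d / d @[d --> 0^'+] --> xi n r 0 0 i.
  exact: (xi_average hH s_dens SS).
have GamA n k i : (k < h)%N -> (k <= n)%N ->
    Gam n k i d / d @[d --> 0^'+] --> gam n k 0 0 i.
  exact: (gam_average hH v_dens SS).
have XiC n r i : (h <= r <= H)%N -> Xi n r i d / mass d @[d --> 0^'+] --> xip n r 0 i.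
  exact: (cl_xi CL).
have GamC n k i : (k < h)%N -> (k <= n)%N ->
    Gam n k i d / mass d @[d --> 0^'+] --> gamp n k 0 i.
  exact: (cl_gam CL).
have [F [f [p [f0 Ff Fp]]]] : exists (F : R -> R) (f p : R), [/\ f != 0,
    F d / d @[d --> 0^'+] --> f & F d / mass d @[d --> 0^'+] --> p].
  have [[n [r [i [hr nz]]]]|[n [k [i [kh kn nz]]]]] :=
    some_completion_flow_neq0 hH mapCD SS.
  - by exists (Xi n r i), (xi n r 0 0 i), (xip n r 0 i); split; auto.
  - by exists (Gam n k i), (gam n k 0 0 i), (gamp n k 0 i); split; auto.
exists (p / f); split => [n r hr|n k kh kn]; apply/rowP => j; rewrite mxE.
  exact: (cvg_ratio_unique f0 Ff (XiA n r j hr) Fp (XiC n r j hr)).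
exact: (cvg_ratio_unique f0 Ff (GamA n k j kh kn) Fp (GamC n k j kh kn)).
Qed.

End CompletionLaw.

Theorem theorem5 (R : realType) (m h H : nat) (eps : bool)
  (C D : 'M[R]_m) (xibar : 'rV[R]_m) (s v : nat -> R -> R)
  (idle : nat -> 'rV[R]_m) (xi gam : nat -> nat -> R -> 'rV[R]_m)
  (xip gamp : nat -> nat -> 'rV[R]_m) :
  (1 <= h <= H)%N ->
  is_map C D ->
  is_stationary (C + D) xibar ->
  (forall r, (h <= r <= H)%N -> is_time_density (s r)) ->
  (forall k, (k < h)%N -> is_time_density (v k)) ->
  arrival_rate D xibar * fine (mean_time (s H)) / H%:R < 1 ->
  is_steady_state h H eps C D s v idle xi gam ->
  is_completion_law h H xi gam xip gamp ->
  (h < H)%N ->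
  forall n : nat,
    xip n h =
      ((1 - eps%:R) *: (\sum_(0 <= j < h)
                          gamp_tot h gamp j *m (Dtilde C D ^+ (h - j)))
       + gamp_tot h gamp h + xip_tot h H xip h) *m arrivals_mx C D (s h) n
    /\ (forall r, (h.+1 <= r <= H.-1)%N ->
          xip n r = (gamp_tot h gamp r + xip_tot h H xip r)
                      *m arrivals_mx C D (s r) n).

Proof.
move=> /andP[h1 _] mapCD _ s_dens v_dens _ SS CL hltH n.
have hH : (1 <= h < H)%N by rewrite h1.
have [c [xipE gampE]] := completion_proportional hH mapCD s_dens v_dens SS CL.
have gamp_totE l : gamp_tot h gamp l = c *: \sum_(0 <= k < (minn l h.-1).+1) gam l k 0.
  rewrite /gamp_tot scaler_sumr; apply: eq_big_nat => k kl.
  by apply: gampE; lia.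
have xip_totE l : xip_tot h H xip l = c *: \sum_(h <= r < H.+1) xi l r 0.
  rewrite /xip_tot scaler_sumr; apply: eq_big_nat => r hr.
  by apply: xipE; lia.
have startE l : (h <= l)%N ->
    gamp_tot h gamp l + xip_tot h H xip l = c *: start_flow h H xi gam l.
  move=> hl; rewrite gamp_totE xip_totE /start_flow scalerDr.
  by have -> : (minn l h.-1).+1 = h by lia.
split => [|r hr].
  rewrite xipE; last by lia.
  rewrite (xi_transform hH mapCD s_dens SS); last by lia.
  rewrite eqxx scalemxAl; congr (_ *m _).
  rewrite -[RHS]addrA startE// scalerDr [RHS]addrC; congr (_ + _).
  rewrite scalerA mulrC -scalerA.
  case epsE: eps; first by rewrite subrr !scale0r.
  rewrite subr0 !scale1r.
  rewrite (idle_closed_form hH mapCD SS) ?epsE//; last by lia.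
  rewrite prednK// mulmx_suml scaler_sumr.
  apply: eq_big_nat => j jh; rewrite gamp_totE.
  have -> : minn j h.-1 = j by lia.
  rewrite -scalemxAl -!mulmxA; congr (_ *: (_ *m _)).
  have -> : (h - j = (h.-1 - j).+1)%N by lia.
  by rewrite exprSr.
rewrite xipE; last by lia.
rewrite (xi_transform hH mapCD s_dens SS); last by lia.
have -> : (r == h) = false by lia.
by rewrite addr0 scalemxAl startE//; lia.
Qed.
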